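(* Let $S$ be a cancellative, countable, abelian semigroup, and suppose that $f\in\ell^{1}(S^* )$. Then $f\in J(S^* )$ if and only if $\operatorname{supp} f\subset K(S^* )$ and $\delta_p\star f\star\delta_q=0$ for each $p,q\in K(S^* )$. Further, in this case, $g\star f$ is nilpotent of index at most $3$ (that is, $(g\star f)^{*3}=0$) for each $g\in\ell^{1}(S^* )$.
   Context: A semigroup $S$ is cancellative if all left and right translations on $S$ are injective. $\beta S$ is the Stone–Čech compactification of the discrete space $S$, and $S^*=\beta S\setminus S$. $\beta S$ carries the semigroup operation $\Box$, the unique associative extension of the operation of $S$ such that $x\mapsto x\,\Box\, v$ is continuous on $\beta S$ for each $v\in\beta S$ and $x\mapsto s\,\Box\, x$ is continuous on $\beta S$ for each $s\in S$. For $S$ (infinite) cancellative, $S^*$ is a closed ideal of $\beta S$ and is a compact right topological semigroup (right translations continuous); $K(S^* )$ is its unique minimum two-sided ideal. (If $S$ is finite, then $S^*=\emptyset$, with the conventions $K(S^* )=\emptyset$ and $\ell^1(S^* )=\{0\}$.) For a semigroup $T$, $\ell^{1}(T)$ is the Banach algebra of absolutely summable complex functions on $T$ with the convolution product $\star$ determined by $\delta_s\star\delta_t=\delta_{st}$, where $\delta_s$ is the characteristic function of $\{s\}$; $\operatorname{supp} f=\{s\in T: f(s)\ne0\}$; $f^{*n}$ is the $n$-th convolution power. $J(T)$ denotes the Jacobson radical of $\ell^{1}(T)$: the intersection of the maximal left ideals of $\ell^{1}(T)^{\#}$ (the algebra with an identity adjoined if it has none). *)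

(* Defs.v *)
From HB Require Import structures.
From mathcomp Require Import all_boot all_order all_algebra.
From mathcomp Require Import complex lra.
From mathcomp Require Import all_classical all_reals.
From mathcomp Require Import topology ereal numfun esum.

Set Implicit Arguments.
Unset Strict Implicit.
Unset Printing Implicit Defensive.

Import Order.TTheory GRing.Theory Num.Theory.

Local Open Scope classical_set_scope.

HB.mixin Record isCancellative S & Semigroup S := {
  mulg_injl : forall s : S, injective (fun t : S => (s * t)%g);
  mulg_injr : forall s : S, injective (fun t : S => (t * s)%g)
}.

#[short(type="cancelSemigroupType")]
HB.structure Definition CancelSemigroup := {S of isCancellative S & Semigroup S}.

(* The Stone-Cech compactification of the discrete space S.
   The points are the ultrafilters on S.  The topology is generated by the sets
   of all ultrafilters containing a given A, and S embeds as the principal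
   ultrafilters.  [beta_compact], [beta_hausdorff], [principal_dense] and
   [beta_extension] below are the characteristic properties. *)
Record beta (S : Type) := Beta {
  beta_filter :> set S -> Prop;
  beta_ultra : UltraFilter beta_filter
}.
#[global] Existing Instance beta_ultra.

HB.instance Definition _ (S : Type) := gen_eqMixin (beta S).
HB.instance Definition _ (S : Type) := gen_choiceMixin (beta S).

Definition principal (S : Type) (s : S) : beta S :=
  Beta (principal_filter_ultra s).

Definition beta_basic (S : Type) (A : set S) : set (beta S) :=
  [set p : beta S | p A].

Lemma betaP (S : Type) (p q : beta S) : (forall A, p A -> q A) -> p = q.
Proof.
case: p q => [p pU] [q qU] /= pq.
have qp : q = p by apply: max_filter.
by rewrite {}qp in qU pq *; congr Beta; exact: Prop_irrelevance.
Qed.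

Lemma betaC (S : Type) (p : beta S) (A : set S) : p (~` A) <-> ~ p A.
Proof.
split=> [pnA pA|npA]; last by case: (in_ultra_setVsetC A (beta_ultra p)).
by have /filter_ex[x []] : p (A `&` ~` A) by exact: filterI.
Qed.

Lemma betaT (S : Type) (p : beta S) : p setT.
Proof. exact: filterT. Qed.

Lemma betaS (S : Type) (p : beta S) (A B : set S) : A `<=` B -> p A -> p B.
Proof. exact: filterS. Qed.

Lemma betaI (S : Type) (p : beta S) (A B : set S) :
  p (A `&` B) <-> p A /\ p B.
Proof.
split=> [pAB|[pA pB]]; last exact: filterI.
by split; move: pAB; apply: filterS => x [].
Qed.

Lemma ultra_setC (S : Type) (F : set_system S) :
  ProperFilter F -> (forall A, F A \/ F (~` A)) -> UltraFilter F.
Proof.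
move=> FF FVC; split=> // G GF FG; apply/seteqP; split=> [A GA|]; last exact: FG.
have [//|/FG GnA] := FVC A.
by have /filter_ex[x []] : G (A `&` ~` A) by exact: filterI.
Qed.

Lemma beta_basic_cover (S : Type) : \bigcup_(A in setT) @beta_basic S A = setT.
Proof. by apply/seteqP; split=> // p _; exists setT => //; exact: filterT. Qed.

Lemma beta_basic_join (S : Type) (A B : set S) (p : beta S) :
  setT A -> setT B -> beta_basic A p -> beta_basic B p ->
  exists C, [/\ setT C, beta_basic C p &
                beta_basic C `<=` beta_basic A `&` beta_basic B].
Proof.
move=> _ _ pA pB; exists (A `&` B); split=> //; first exact: filterI.
by move=> q /betaI.
Qed.

Lemma principalE (S : Type) (s : S) (A : set S) : principal s A <-> A s.
Proof. exact: principal_filterP. Qed.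

HB.instance Definition _ (S : Type) := @isBaseTopological.Build (beta S) (set S)
  setT (@beta_basic S) (@beta_basic_cover S) (@beta_basic_join S).

Section BetaTopology.
Variable S : Type.
Implicit Types (p q : beta S) (A B : set S).

Lemma beta_basic_open A : open (beta_basic A).
Proof. by exists [set A] => //; rewrite bigcup_set1. Qed.

Lemma beta_basic_clopen A : clopen (beta_basic A).
Proof.
split; first exact: beta_basic_open.
rewrite -openC (_ : ~` _ = beta_basic (~` A)); first exact: beta_basic_open.
by apply/seteqP; split=> p /betaC.
Qed.

Lemma nbhs_betaP p (U : set (beta S)) :
  nbhs p U <-> exists2 A, p A & beta_basic A `<=` U.
Proof.
split=> [|[A pA AU]].
  rewrite nbhsE => -[V [[D _ <-] [A DA pA]] VU]; exists A => // q qA.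
  by apply: VU; exists A.
by rewrite nbhsE; exists (beta_basic A) => //; split=> //; exact: beta_basic_open.
Qed.

Lemma beta_compact : compact [set: beta S].
Proof.
rewrite compact_ultra => F FU _.
have qU : UltraFilter [set A | F (@beta_basic S A)].
  apply: ultra_setC => [|A].
    apply: Build_ProperFilter_ex => [A FA|].
      have [p pA] := @filter_ex _ F _ _ FA.
      exact: (@filter_ex _ p _ _ pA).
    split=> [|A B FA FB|A B AB FA].
    - by apply: filterS (filterT : F setT) => p _; exact: filterT.
    - have : F (beta_basic A `&` beta_basic B) by exact: filterI.
      by apply: filterS => p [pA pB]; apply/betaI.
    - by apply: (@filterS _ F _ _ _ _ FA) => p; exact: filterS.
  have [FA|FA] := in_ultra_setVsetC (beta_basic A) FU; [by left|right].
  by apply: (@filterS _ F _ _ _ _ FA) => p npA; apply/betaC.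
exists (Beta qU); split=> // U /nbhs_betaP[A /= FA AU].
exact: filterS FA.
Qed.

Lemma beta_hausdorff : hausdorff_space (beta S).
Proof.
move=> p q pq; apply: betaP => A pA; apply: contrapT => /betaC qA.
have [] := pq (beta_basic A) (beta_basic (~` A)).
- by apply/nbhs_betaP; exists A.
- by apply/nbhs_betaP; exists (~` A).
- by move=> r [rA /betaC].
Qed.

Lemma principal_inj : injective (@principal S).
Proof.
move=> s t st; have : principal s [set s] by exact/principal_filterP.
by rewrite st => /principal_filterP ->.
Qed.

Lemma principal_dense : dense (range (@principal S)).
Proof.
move=> U [p Up] oU; have /nbhs_betaP[A /filter_ex[s As] AU] : nbhs p U.
  exact: open_nbhs_nbhs.
by exists (principal s); split; [apply/AU/principal_filterP|exists s].
Qed.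

Lemma beta_extension (K : topologicalType) (f : S -> K) :
  compact [set: K] -> hausdorff_space K ->
  exists2 g : beta S -> K, continuous g & forall s, g (principal s) = f s.
Proof.
move=> cK hK.
have fpU (p : beta S) : UltraFilter (fmap f (beta_filter p)).
  apply: ultra_setC => A.
  exact: (in_ultra_setVsetC (f @^-1` A) (beta_ultra p)).
have lim_ex (p : beta S) : exists x : K, nbhs x `<=` fmap f (beta_filter p).
  by move: cK; rewrite compact_ultra => /(_ _ (fpU p) filterT)[x []]; exists x.
have [g gP] := choice lim_ex.
exists g => [p V|s]; last first.
  apply: (@cvg_unique _ hK _ (@ultra_proper _ _ (fpU (principal s)))).
    exact: gP.
  by move=> V /nbhs_singleton Vs; apply/principal_filterP.
have regK : {for g p, @regular_space K}.
  by apply: (compact_regular hK cK); exact: filterT.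
move=> /regK[W gW WV].
apply/nbhs_betaP; exists (f @^-1` W); first exact: gP.
move=> q qW; apply: WV => B /gP qB.
have /filter_ex[s [Ws Bs]] : q (f @^-1` W `&` f @^-1` B) by exact: filterI.
by exists (f s).
Qed.

End BetaTopology.

(* [A] belongs to [p * q] iff [{s | {t | s t in A} in q}] belongs to [p], that
   is, [p * q] is the limit along [s -> p] of the limits along [t -> q] of the
   products [s t].  By [beta_mul_unique] below this is the only extension of the
   operation of S with the required continuity properties. *)
Section BetaSemigroup.
Variable S : semigroupType.
Implicit Types (p q r : beta S) (A : set S).

Definition beta_mul_filter p q : set_system S :=
  [set A | p [set s | q [set t | A (s * t)%g]]].

Lemma beta_mul_ultra p q : UltraFilter (beta_mul_filter p q).
Proof.
apply: ultra_setC => [|A].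
  apply: Build_ProperFilter_ex => [A pA|].
    have [s /(@filter_ex _ q)[t Ast]] := @filter_ex _ p _ _ pA.
    by exists (s * t)%g.
  split=> [|A B pA pB|A B AB pA].
  - by apply: betaS (betaT p) => s _; exact: betaT.
  - by apply: betaS (iffRL (betaI p _ _) (conj pA pB)) => s /betaI.
  - by apply: betaS pA => s; apply: betaS => t; exact: AB.
have [pA|pA] := in_ultra_setVsetC [set s | q [set t | A (s * t)%g]]
  (beta_ultra p); [by left|right].
by apply: betaS pA => s /betaC.
Qed.

Definition beta_mul p q : beta S := Beta (beta_mul_ultra p q).

Lemma beta_mulA : associative beta_mul.
Proof.
move=> p q r; apply: betaP => A; rewrite /= /beta_mul_filter /=.
apply: betaS => s; apply: betaS => t /=; apply: betaS => u /=.
by rewrite mulgA.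
Qed.

HB.instance Definition _ := isSemigroup.Build (beta S) beta_mulA.

Lemma beta_mulE p q A :
  (p * q)%g A <-> p [set s | q [set t | A (s * t)%g]].
Proof. by []. Qed.

Lemma principalM (s t : S) : principal (s * t)%g = (principal s * principal t)%g.
Proof.
apply: betaP => A /principalE Ast; apply/beta_mulE.
apply/principalE => /=; exact/principalE.
Qed.

Lemma beta_mulr_continuous q : continuous (fun p : beta S => (p * q)%g).
Proof.
move=> p U /nbhs_betaP[A pqA AU]; apply/nbhs_betaP.
by exists [set s | q [set t | A (s * t)%g]] => // r rA; exact: AU.
Qed.

Lemma beta_mull_continuous (s : S) :
  continuous (fun p : beta S => (principal s * p)%g).
Proof.
move=> p U /nbhs_betaP[A /beta_mulE/principalE pA AU]; apply/nbhs_betaP.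
exists [set t | A (s * t)%g] => // r rA.
by apply: AU; apply/beta_mulE/principalE.
Qed.

Lemma beta_mul_unique (op : beta S -> beta S -> beta S) :
  (forall s t, op (principal s) (principal t) = principal (s * t)%g) ->
  (forall q, continuous (op^~ q)) ->
  (forall s, continuous (op (principal s))) ->
  forall p q, op p q = (p * q)%g.
Proof.
move=> opE opr opl.
have nbhsC (f : beta S -> beta S) p A : continuous f -> ~ f p A ->
    exists2 B, p B & forall r : beta S, r B -> ~ f r A.
  move=> cf /betaC fA; have /cf/nbhs_betaP[B pB BA] : nbhs (f p) (beta_basic (~` A)).
    by apply/nbhs_betaP; exists (~` A).
  by exists B => // r /BA/betaC.
have op_principal s q A : q [set t | A (s * t)%g] -> op (principal s) q A.
  move=> qA; apply: contrapT => /(nbhsC _ _ _ (opl s))[B qB BA].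
  have [t [Bt At]] := @filter_ex _ q _ _ (iffRL (betaI q _ _) (conj qB qA)).
  by apply: (BA (principal t)); [apply/principalE|rewrite opE; apply/principalE].
move=> p q; apply/esym/betaP => A /beta_mulE pqA.
apply: contrapT => /(nbhsC _ _ _ (opr q))[B pB BA].
have [s [Bs qs]] := @filter_ex _ p _ _ (iffRL (betaI p _ _) (conj pB pqA)).
by apply: (BA (principal s)); [apply/principalE|exact: op_principal].
Qed.

End BetaSemigroup.

Definition remainder (S : Type) : set (beta S) := ~` range (@principal S).

Lemma remainderP (S : Type) (p : beta S) :
  remainder p <-> forall s, ~ p [set s].
Proof.
split=> [pS s ps|pS [s _ sp]]; last first.
  by apply: (pS s); rewrite -sp; apply/principalE.
apply: pS; exists s => //; apply: betaP => A /principalE As.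
by apply: betaS ps => _ ->.
Qed.

(* S^*, that is, beta S \ S, as a type. *)
Definition star (S : Type) : Type := set_type (@remainder S).

HB.instance Definition _ (S : Type) := SubChoice.on (star S).

Lemma remainder_mulg_closed (S : cancelSemigroupType) :
  mulg_closed (mem (@remainder S)).
Proof.
move=> p q; rewrite !inE => /remainderP pS /remainderP qS; apply/remainderP => u.
move=> /beta_mulE/(@filter_ex _ p)[s /= qs].
have [t /= stu] := @filter_ex _ q _ _ qs.
apply: (qS t); apply: betaS qs => t' /=.
by rewrite -stu => /mulg_injl.
Qed.

HB.instance Definition _ (S : cancelSemigroupType) :=
  SubChoice_isSubSemigroup.Build (beta S) (mem (@remainder S)) (star S)
    (@remainder_mulg_closed S).

Definition semigroup_ideal (T : semigroupType) (I : set T) :=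
  I !=set0 /\ forall s t, I s -> I (s * t)%g /\ I (t * s)%g.

(* The minimum two-sided ideal of T whenever there is one, and the empty set if
   T is empty. *)
Definition min_ideal (T : semigroupType) : set T :=
  \bigcap_(I in @semigroup_ideal T) I.

Lemma min_idealP (T : semigroupType) (M : set T) : semigroup_ideal M ->
  (forall I, semigroup_ideal I -> M `<=` I) -> @min_ideal T = M.
Proof.
by move=> Mi Mmin; apply/seteqP; split=> [s|s Ms I Ii]; [apply|exact: Mmin Ii _ _].
Qed.

Import complex.

Local Open Scope ring_scope.
Local Open Scope complex_scope.

Section ComplexSum.
Context {R : realType} {I : choiceType}.
Implicit Types (D : set I) (u : I -> R) (F : I -> R[i]).

(* The unordered sum over D of an absolutely summable family. *)
Definition rsum D u : R :=
  let f : I -> \bar R := EFin \o u in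
  fine (esum D f^\+ - esum D f^\-)%E.

Definition csum D F : R[i] :=
  rsum D (fun i => Re (F i)) +i* rsum D (fun i => Im (F i)).

Lemma rsum_le D u : (`|rsum D u|%:E <= \esum_(i in D) `|u i|%:E)%E.
Proof.
have [uoo|] := ltP (\esum_(i in D) `|u i|%:E)%E +oo%E; last first.
  by move=> /(le_trans _); apply; rewrite leey.
rewrite /rsum; set f : I -> \bar R := EFin \o u.
have uS : summable D f by [].
have pS := summable_funepos uS; have nS := summable_funeneg uS.
have fp : esum D f^\+%E \is a fin_num.
  move: pS; rewrite summableE; congr (_ \is a fin_num).
  by apply: eq_esum => i _; rewrite gee0_abs.
have fn : esum D f^\-%E \is a fin_num.
  move: nS; rewrite summableE; congr (_ \is a fin_num).
  by apply: eq_esum => i _; rewrite gee0_abs.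
rewrite -abse_EFin fineK ?fin_numB ?fp//.
apply: (le_trans (lee_abs_sub _ _)).
rewrite !gee0_abs ?esum_ge0//.
rewrite -esumD//.
by apply: le_esum => i _; rewrite -[leLHS]/((f^\+ \+ f^\-)%E i) -fune_abse.
Qed.

Lemma normc_ReIm (z : R[i]) : Normc.normc z <= `|Re z| + `|Im z|.
Proof.
case: z => a b /=; rewrite -[leRHS]ger0_norm ?addr_ge0// -sqrtr_sqr ler_wsqrtr//.
by rewrite sqrrD !real_normK ?num_real// lerD2r lerDl mulrn_wge0 ?mulr_ge0.
Qed.

Lemma Re_le_normc (z : R[i]) : `|Re z| <= Normc.normc z.
Proof. by case: z => a b /=; rewrite -sqrtr_sqr ler_wsqrtr// lerDl sqr_ge0. Qed.

Lemma Im_le_normc (z : R[i]) : `|Im z| <= Normc.normc z.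
Proof. by case: z => a b /=; rewrite -sqrtr_sqr ler_wsqrtr// lerDr sqr_ge0. Qed.

Lemma normc_ge0 (z : R[i]) : 0 <= Normc.normc z.
Proof. by case: z => a b; exact: sqrtr_ge0. Qed.

Lemma csum_le D F : ((Normc.normc (csum D F))%:E <=
  \esum_(i in D) (Normc.normc (F i))%:E + \esum_(i in D) (Normc.normc (F i))%:E)%E.
Proof.
apply: (@le_trans _ _ (`|rsum D (fun i => Re (F i))|%:E +
                       `|rsum D (fun i => Im (F i))|%:E)%E).
  by rewrite -EFinD lee_fin; exact: normc_ReIm.
apply: leeD; apply: (le_trans (rsum_le _ _)); apply: le_esum => i _; rewrite lee_fin.
  exact: Re_le_normc.
exact: Im_le_normc.
Qed.

End ComplexSum.

Lemma esumZl_le (R : realType) (I : choiceType) (D : set I) (c : R)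
    (a : I -> \bar R) : 0 <= c -> (forall i, 0 <= a i)%E ->
  (\esum_(i in D) (c%:E * a i) <= c%:E * \esum_(i in D) a i)%E.
Proof.
move=> c0 a0; apply: ge_ereal_sup => _ [A AD <-].
rewrite -ge0_mule_fsumr//; apply: lee_wpmul2l; first by rewrite lee_fin.
by apply: ereal_sup_ubound; exists A.
Qed.

Section L1.
Variables (R : realType) (T : choiceType).

Definition l1_pred : {pred T -> R[i]^o} :=
  mem [set f : T -> R[i]^o | summable setT (fun t => (Normc.normc (f t))%:E)].

(* The regular module R[i]^o is what makes T -> R[i] a complex vector space. *)
Record l1 := L1 {
  l1_fun :> T -> R[i]^o;
  l1_summable : l1_fun \in l1_pred
}.

HB.instance Definition _ := [isSub for l1_fun].
HB.instance Definition _ := [Choice of l1 by <:].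

Lemma l1P (f : T -> R[i]^o) :
  f \in l1_pred <-> (\esum_(t in setT) (Normc.normc (f t))%:E < +oo)%E.
Proof.
rewrite inE /= /summable; under eq_esum => t _ do
  rewrite gee0_abs ?lee_fin ?normc_ge0//.
by [].
Qed.

Lemma l1_submod_closed : submod_closed l1_pred.
Proof.
split=> [|a f g /l1P fS /l1P gS]; apply/l1P.
  rewrite esum1 ?ltry// => t _; rewrite Normc.normc0//.
apply: (@le_lt_trans _ _ ((Normc.normc a)%:E *
    (\esum_(t in setT) (Normc.normc (f t))%:E) +
    \esum_(t in setT) (Normc.normc (g t))%:E)%E); last first.
  apply: lte_add_pinfty => //; rewrite lte_mul_pinfty ?lee_fin ?normc_ge0//.
apply: le_trans (leeD (esumZl_le _ _ _) (lexx _)).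
- rewrite -esumD; last 2 first.
  + by move=> t _; rewrite -EFinM lee_fin mulr_ge0 ?normc_ge0.
  + by move=> t _; rewrite lee_fin normc_ge0.
  apply: le_esum => t _; rewrite -EFinM -EFinD lee_fin -Normc.normcM.
  exact: le_normcD.
- exact: normc_ge0.
- by move=> t; rewrite lee_fin normc_ge0.
Qed.

HB.instance Definition _ :=
  GRing.isSubmodClosed.Build R[i] (T -> R[i]^o) l1_pred l1_submod_closed.
HB.instance Definition _ := [SubChoice_isSubLmodule of l1 by <:].

Lemma dirac_summable (s : T) :
  (fun t => if t == s then 1 else 0 : R[i]^o) \in l1_pred.
Proof.
apply/l1P; rewrite (esumID [set s])//; last first.
  by move=> t _; rewrite lee_fin normc_ge0.
rewrite setTI esum_set1 ?lee_fin ?normc_ge0// eqxx Normc.normc1.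
rewrite esum1 ?adde0 ?ltry// => t /= [_ /eqP/negPf ->].
by rewrite Normc.normc0.
Qed.

Definition l1_delta (s : T) : l1 := L1 (dirac_summable s).

Definition supp (f : l1) : set T := [set t | f t != 0].

End L1.

Section Convolution.
Variables (R : realType) (T : semigroupType).
Implicit Types f g : l1 R T.

Definition conv_fun f g : T -> R[i]^o := fun t =>
  csum [set rs : T * T | (rs.1 * rs.2)%g = t] (fun rs => f rs.1 * g rs.2).

Lemma conv_summable f g : conv_fun f g \in @l1_pred R T.
Proof.
apply/l1P; pose J (t : T) := [set rs : T * T | (rs.1 * rs.2)%g = t].
pose a (rs : T * T) : \bar R := (Normc.normc (f rs.1 * g rs.2))%:E.
have a0 rs : (0 <= a rs)%E by rewrite lee_fin normc_ge0.
have /l1P fS := l1_summable f; have /l1P gS := l1_summable g.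
have aS : (\esum_(t in setT) \esum_(rs in J t) a rs < +oo)%E.
  rewrite (@esum_esum _ _ _ _ J (fun=> a))//=.
  rewrite (reindex_esum setT _ (fun rs : T * T => ((rs.1 * rs.2)%g, rs)))//=;
    last first.
    split=> [rs _//|rs1 rs2 _ _ [_ ->//]|[t rs] /= [_ <-]]; by exists rs.
  rewrite -setXTT -(@esum_esum _ _ _ setT (fun=> setT) (fun r s => a (r, s)))//.
  have fg r : (\esum_(s in setT) a (r, s) <=
      (\esum_(s in setT) (Normc.normc (g s))%:E) * (Normc.normc (f r))%:E)%E.
    rewrite muleC; apply: le_trans (esumZl_le _ _ _).
    - by apply: le_esum => s _; rewrite /a Normc.normcM EFinM.
    - exact: normc_ge0.
    - by move=> s; rewrite lee_fin normc_ge0.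
  apply: (@le_lt_trans _ _ (\esum_(r in setT) ((\esum_(s in setT)
      (Normc.normc (g s))%:E) * (Normc.normc (f r))%:E)))%E.
    by apply: le_esum => r _; exact: fg.
  have g0 : (0 <= \esum_(s in setT) (Normc.normc (g s))%:E)%E.
    by apply: esum_ge0 => s _; rewrite lee_fin normc_ge0.
  have gfin : (\esum_(s in setT) (Normc.normc (g s))%:E)%E \is a fin_num.
    by rewrite ge0_fin_numE.
  rewrite -(fineK gfin); apply: le_lt_trans (esumZl_le _ _ _) _.
  - exact: fine_ge0.
  - by move=> r; rewrite lee_fin normc_ge0.
  - by rewrite lte_mul_pinfty ?lee_fin ?fine_ge0.
apply: le_lt_trans (lte_add_pinfty aS aS).
rewrite -esumD; [|by move=> t _; exact: esum_ge0|by move=> t _; exact: esum_ge0].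
by apply: le_esum => t _; exact: csum_le.
Qed.

Definition conv f g : l1 R T := L1 (conv_summable f g).

End Convolution.

Notation "f \star g" := (conv f g) (at level 40, left associativity) : ring_scope.

Lemma rsum_supp1 (R : realType) (I : choiceType) (D : set I) (u : I -> R)
    (i : I) : (forall j, D j -> j != i -> u j = 0) ->
  rsum D u = if i \in D then u i else 0.
Proof.
have esum_supp1 (a : I -> \bar R) : (forall j, 0 <= a j)%E ->
    (forall j, D j -> j != i -> a j = 0%E) ->
    esum D a = if i \in D then a i else 0%E.
  move=> a0 ai; rewrite (esumID [set i])// [X in (_ + X)%E]esum1 ?adde0; last first.
    by move=> j [Dj /eqP]; exact: ai.
  by rewrite setI1; case: ifPn => _; rewrite ?esum_set1// esum_set0.
move=> ui; rewrite /rsum !esum_supp1// => [|j Dj ji|j Dj ji]; last 2 first.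
- by rewrite funenegE /= ui// oppr0 maxxx.
- by rewrite funeposE /= ui// maxxx.
case: ifPn => _; last by rewrite sube0.
rewrite funeposE funenegE /= -[0%E]/(0%:E) -!EFin_max -EFinB /=.
by case: (lerP (u i) 0); case: (lerP (- u i) 0) => *; lra.
Qed.

Lemma l1_deltaM (R : realType) (T : semigroupType) (s t : T) :
  l1_delta R s \star l1_delta R t = l1_delta R (s * t)%g.
Proof.
apply/val_inj/funext => u /=; rewrite /conv_fun /csum.
have h0 (rs : T * T) : rs != (s, t) -> l1_delta R s rs.1 * l1_delta R t rs.2 = 0.
  case: rs => r1 r2; rewrite xpair_eqE negb_and /= => /orP[]/negPf->.
    by rewrite mul0r.
  by rewrite mulr0.
rewrite !(@rsum_supp1 _ _ _ _ (s, t)); try by move=> rs _ /h0 ->.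
rewrite /= !eqxx mulr1; have [->|ust] := eqVneq u (s * t)%g; first by rewrite mem_set.
by rewrite memNset//=; apply/eqP; rewrite eq_sym.
Qed.

(* An associative algebra, not necessarily unital, is given by a module A and
   its multiplication m. *)
Section JacobsonRadical.
Variables (K : fieldType) (A : lmodType K) (m : A -> A -> A).

Definition has_identity := exists e, forall x, m e x = x /\ m x e = x.

Definition left_ideal (I : set A) :=
  [/\ I 0, forall (a : K) x y, I x -> I y -> I (a *: x + y)
         & forall x y, I y -> I (m x y)].

Definition maximal_left_ideal (M : set A) :=
  [/\ left_ideal M, M <> setT
    & forall I, left_ideal I -> M `<=` I -> I = M \/ I = setT].

(* (a, x) stands for a 1 + x. *)
Definition unitization (u v : K^o * A) : K^o * A :=
  (u.1 * v.1, u.1 *: v.2 + v.1 *: u.2 + m u.2 v.2).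

End JacobsonRadical.

(* The elements of A lying in every maximal left ideal of A^#, where A^# is A if A
   has an identity and the unitization of A otherwise. *)
Definition jacobson_radical (K : fieldType) (A : lmodType K) (m : A -> A -> A) :
    set A :=
  [set x | (has_identity m -> forall M, maximal_left_ideal m M -> M x) /\
    (~ has_identity m ->
      forall M, maximal_left_ideal (unitization m) M -> M (0, x))].

(* Main.v *)
Require Import Defs.
From mathcomp Require Import all_boot all_order all_algebra.
From mathcomp Require Import complex ring lra.
From mathcomp Require Import all_classical all_reals.
From mathcomp Require Import finmap topology ereal numfun esum.

(* Let T be the remainder of beta S, K its minimal ideal and J the radical of
   l^1(T).

   If f lives on K and d_p f d_q = 0 for p, q in K, then h f k = 0 for all h, k
   in l^1(K); since f and g f live on K, the cube of a f + g f vanishes, so f is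
   in J.

   Conversely, for f in J every x f has a left quasi-inverse: g = x f + g x f.
   Fix an idempotent e in a minimal left ideal; then G = e T e is a group and
   K = T e T.  For p = a e b and q = c e d the element k = d_{eb} f d_{ce} lies
   in l^1(G), and 1 - r k' k is left invertible in l^1(G) for all real r, where
   k' is the adjoint of k.  With M the supremum of the ratios of consecutive
   moments of k' k, its powers are approximate eigenvectors for M in l^2(G),
   which contradicts the case r = 1/M unless k = 0.

   For the support, suppose f(p) <> 0 with p outside K.  A limit point q of a
   sparse sequence in S can be chosen such that t q s = w q r, with s, r in the
   support of f but outside K, forces a s = c r for some a, c in S, and such
   that q p is right cancellable.  The part of f on the s with a s = c p is
   turned into phi in l^1(G) by recording the ratio c/a, an element of the
   centre of G, and phi(e) = f(p).  In g = r q f + g (r q f) the part of g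
   on the orbit of (q p)^n is r^n phi^n, so the norms of r^n phi^n are bounded
   for each r; but phi is normal, so the l^2 norm of phi^n is at least the n-th
   power of that of phi. *)

Set Implicit Arguments.
Unset Strict Implicit.
Unset Printing Implicit Defensive.

Import Order.TTheory GRing.Theory Num.Theory.
Import complex.
Local Open Scope classical_set_scope.
Local Open Scope ring_scope.
Local Open Scope complex_scope.

Local Notation normc := Normc.normc.

(** * Sums of complex families *)

Section Sums.
Variables (R : realType) (I : choiceType).
Implicit Types (D : set I) (u v p q : I -> R) (F G : I -> R[i]).

Definition abs_summable D F := (\esum_(i in D) (normc (F i))%:E < +oo)%E.

(** The positive part of a sum is not the sum of the positive parts; additivity of [rsum] therefore
    rests on the freedom to use any splitting into nonnegative summable families. *)
Lemma rsum_diff D u p q : (forall i, 0 <= p i) -> (forall i, 0 <= q i) ->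
  (\esum_(i in D) (p i)%:E < +oo)%E -> (\esum_(i in D) (q i)%:E < +oo)%E ->
  (forall i, D i -> u i = p i - q i) ->
  rsum D u = fine (\esum_(i in D) (p i)%:E) - fine (\esum_(i in D) (q i)%:E).
Proof.
move=> p0 q0 ps qs uE.
have nneg_fin (w : I -> R) : (forall i, 0 <= w i) ->
    (\esum_(i in D) (w i)%:E < +oo)%E -> (\esum_(i in D) (w i)%:E)%E \is a fin_num.
  by move=> w0 ws; rewrite ge0_fin_numE// esum_ge0// => i _; rewrite lee_fin.
have nneg_summable (w : I -> R) : (forall i, 0 <= w i) ->
    (\esum_(i in D) (w i)%:E < +oo)%E -> summable D (EFin \o w).
  move=> w0 ws; rewrite /summable (eq_esum (b := fun i => (w i)%:E))// => i _ /=.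
  by rewrite ger0_norm.
rewrite -fineB ?nneg_fin// -(@esumB _ _ D (EFin \o p) (EFin \o q)); last 4 first.
- exact: nneg_summable.
- exact: nneg_summable.
- by move=> i _; rewrite lee_fin.
- by move=> i _; rewrite lee_fin.
rewrite /rsum; congr (fine (_ - _)%E); apply: eq_esum => i Di.
  by rewrite !funeposE /= uE.
by rewrite !funenegE /= uE.
Qed.

Lemma abs_summableW D F u : (forall i, D i -> 0 <= u i <= normc (F i)) ->
  abs_summable D F -> (\esum_(i in D) (u i)%:E < +oo)%E.
Proof.
move=> uF; apply: le_lt_trans; apply: le_esum => i /uF /andP[_].
by rewrite lee_fin.
Qed.

Lemma le_abs_summable D F G : (forall i, D i -> normc (F i) <= normc (G i)) ->
  abs_summable D G -> abs_summable D F.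
Proof. by move=> FG; apply: abs_summableW => i /FG; rewrite normc_ge0. Qed.

Lemma abs_summableZ D F (c : R[i]) : abs_summable D F ->
  abs_summable D (fun i => c * F i).
Proof.
move=> Fs; apply: (@le_lt_trans _ _ ((normc c)%:E * \esum_(i in D) (normc (F i))%:E)%E).
  apply: le_trans (esumZl_le _ _ _).
  - by apply: le_esum => i _; rewrite -EFinM lee_fin Normc.normcM.
  - exact: normc_ge0.
  - by move=> i; rewrite lee_fin normc_ge0.
by rewrite lte_mul_pinfty ?lee_fin ?normc_ge0.
Qed.

Lemma posr_le (x : R) : 0 <= Num.max x 0 <= `|x|.
Proof. by rewrite le_max lexx orbT ge_max normr_ge0 ler_norm. Qed.

Lemma posr_sub (x : R) : x = Num.max x 0 - Num.max (- x) 0.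
Proof. by case: (lerP x 0); case: (lerP (- x) 0) => *; lra. Qed.

(** Domination by a complex family [F] is the form in which real and imaginary parts inherit
    summability. *)
Lemma rsumE D u F : (forall i, D i -> `|u i| <= normc (F i)) -> abs_summable D F ->
  rsum D u = fine (\esum_(i in D) (Num.max (u i) 0)%:E) -
             fine (\esum_(i in D) (Num.max (- u i) 0)%:E).
Proof.
move=> uF Fs; apply: rsum_diff => [i|i|||i _]; last exact: posr_sub.
- by case/andP: (posr_le (u i)).
- by case/andP: (posr_le (- u i)).
- apply: abs_summableW Fs => i /uF; have /andP[-> /=] := posr_le (u i).
  exact: le_trans.
- apply: abs_summableW Fs => i /uF; have /andP[-> /=] := posr_le (- u i).
  by rewrite normrN; exact: le_trans.
Qed.

Lemma esum_fineD D p q : (forall i, 0 <= p i) -> (forall i, 0 <= q i) ->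
  (\esum_(i in D) (p i)%:E < +oo)%E -> (\esum_(i in D) (q i)%:E < +oo)%E ->
  (\esum_(i in D) (p i + q i)%:E < +oo)%E /\
  fine (\esum_(i in D) (p i + q i)%:E) =
  fine (\esum_(i in D) (p i)%:E) + fine (\esum_(i in D) (q i)%:E).
Proof.
move=> p0 q0 ps qs.
have fin (w : I -> R) : (forall i, 0 <= w i) ->
    (\esum_(i in D) (w i)%:E < +oo)%E -> (\esum_(i in D) (w i)%:E)%E \is a fin_num.
  by move=> w0 ws; rewrite ge0_fin_numE// esum_ge0// => i _; rewrite lee_fin.
have -> : (\esum_(i in D) (p i + q i)%:E =
    \esum_(i in D) (p i)%:E + \esum_(i in D) (q i)%:E)%E.
  rewrite -esumD// => i _; by rewrite lee_fin.
by rewrite fineD ?fin// lte_add_pinfty.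
Qed.

Lemma rsumD D u v F G :
  (forall i, D i -> `|u i| <= normc (F i)) -> abs_summable D F ->
  (forall i, D i -> `|v i| <= normc (G i)) -> abs_summable D G ->
  rsum D (fun i => u i + v i) = rsum D u + rsum D v.
Proof.
move=> uF Fs vG Gs; rewrite (rsumE uF Fs) (rsumE vG Gs).
have m0 (x : R) : 0 <= Num.max x 0 by case/andP: (posr_le x).
have su (w : I -> R) H : (forall i, D i -> `|w i| <= normc (H i)) -> abs_summable D H ->
    (\esum_(i in D) (Num.max (w i) 0)%:E < +oo)%E.
  by move=> wH; apply: abs_summableW => i /wH; rewrite m0 /=; apply: le_trans;
    case/andP: (posr_le (w i)).
have uF' i : D i -> `|- u i| <= normc (F i) by rewrite normrN; exact: uF.
have vG' i : D i -> `|- v i| <= normc (G i) by rewrite normrN; exact: vG.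
have [s1 e1] := esum_fineD (fun i => m0 (u i)) (fun i => m0 (v i))
  (su _ _ uF Fs) (su _ _ vG Gs).
have [s2 e2] := esum_fineD (fun i => m0 (- u i)) (fun i => m0 (- v i))
  (su _ _ uF' Fs) (su _ _ vG' Gs).
rewrite (@rsum_diff D _ (fun i => Num.max (u i) 0 + Num.max (v i) 0)
  (fun i => Num.max (- u i) 0 + Num.max (- v i) 0))//.
- by rewrite e1 e2; lra.
- by move=> i; rewrite addr_ge0.
- by move=> i; rewrite addr_ge0.
- by move=> i _; have := posr_sub (u i); have := posr_sub (v i); lra.
Qed.

Lemma esum_fineZ D p c : 0 <= c -> (forall i, 0 <= p i) ->
  (\esum_(i in D) (p i)%:E < +oo)%E ->
  (\esum_(i in D) (c * p i)%:E < +oo)%E /\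
  fine (\esum_(i in D) (c * p i)%:E) = c * fine (\esum_(i in D) (p i)%:E).
Proof.
move=> c0 p0 ps.
have pfin : (\esum_(i in D) (p i)%:E)%E \is a fin_num.
  by rewrite ge0_fin_numE// esum_ge0// => i _; rewrite lee_fin.
have E : (\esum_(i in D) (c * p i)%:E = c%:E * \esum_(i in D) (p i)%:E)%E.
  apply/eqP; rewrite eq_le; apply/andP; split.
    by apply: le_trans (esumZl_le _ c0 _) => // i; rewrite lee_fin.
  have [{}c0|] := ltP 0 c; last first.
    move=> c0'; rewrite (_ : c = 0) ?mul0e; last by apply/le_anti; rewrite c0 c0'.
    by rewrite esum_ge0// => i _; rewrite mul0r.
  (* The reverse inequality is [esumZl_le] for the inverse of [c]. *)
  rewrite -lee_pdivlMl//; apply: le_trans (esumZl_le _ _ _) => //.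
  - by apply: le_esum => i _; rewrite -EFinM lee_fin mulrA mulVf ?mul1r// gt_eqF.
  - by rewrite invr_ge0 ltW.
  - by move=> i; rewrite lee_fin mulr_ge0// ltW.
by rewrite E fineM// lte_mul_pinfty ?lee_fin.
Qed.

Lemma rsumN D u : rsum D (fun i => - u i) = - rsum D u.
Proof.
rewrite /rsum.
have -> : esum D (EFin \o (fun i => (- u i)%R))^\+%E = esum D (EFin \o u)^\-%E.
  by apply: eq_esum => i _; rewrite funeposE funenegE.
have -> : esum D (EFin \o (fun i => (- u i)%R))^\-%E = esum D (EFin \o u)^\+%E.
  by apply: eq_esum => i _; rewrite funeposE funenegE /= opprK.
set a := esum _ _; set b := esum _ _.
have : (0 <= a)%E by apply: esum_ge0.
have : (0 <= b)%E by apply: esum_ge0.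
by case: a b => [a||] [b||] //= _ _; rewrite ?oppr0// opprB.
Qed.

Lemma rsumZ D u F c : (forall i, D i -> `|u i| <= normc (F i)) -> abs_summable D F ->
  rsum D (fun i => c * u i) = c * rsum D u.
Proof.
move=> uF Fs.
wlog c0 : c / 0 <= c => [H|].
  have [/H//|c0] := leP 0 c.
  rewrite -[c]opprK mulNr -H ?oppr_ge0 1?ltW// -rsumN.
  by congr rsum; apply/funext => i; rewrite mulNr.
have m0 (x : R) : 0 <= Num.max x 0 by case/andP: (posr_le x).
have su (w : I -> R) H : (forall i, D i -> `|w i| <= normc (H i)) -> abs_summable D H ->
    (\esum_(i in D) (Num.max (w i) 0)%:E < +oo)%E.
  by move=> wH; apply: abs_summableW => i /wH; rewrite m0 /=; apply: le_trans;
    case/andP: (posr_le (w i)).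
have uF' i : D i -> `|- u i| <= normc (F i) by rewrite normrN; exact: uF.
rewrite (rsumE uF Fs).
have [s1 e1] := esum_fineZ c0 (fun i => m0 (u i)) (su _ _ uF Fs).
have [s2 e2] := esum_fineZ c0 (fun i => m0 (- u i)) (su _ _ uF' Fs).
rewrite (@rsum_diff D _ (fun i => c * Num.max (u i) 0) (fun i => c * Num.max (- u i) 0))//.
- by rewrite e1 e2 mulrBr.
- by move=> i; rewrite mulr_ge0.
- by move=> i; rewrite mulr_ge0.
- by move=> i _; rewrite -mulrBr -posr_sub.
Qed.

Lemma csumD D F G : abs_summable D F -> abs_summable D G ->
  csum D (fun i => F i + G i) = csum D F + csum D G.
Proof.
move=> Fs Gs; rewrite /csum.
rewrite -[RHS]/(Complex (_ + _) (_ + _)).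
rewrite -(rsumD (fun i _ => Re_le_normc (F i)) Fs (fun i _ => Re_le_normc (G i)) Gs).
rewrite -(rsumD (fun i _ => Im_le_normc (F i)) Fs (fun i _ => Im_le_normc (G i)) Gs).
by congr (_ +i* _); congr (rsum D _); apply/funext => i; case: (F i) (G i) => [? ?] [].
Qed.

Lemma csumZ D F (c : R[i]) : abs_summable D F ->
  csum D (fun i => c * F i) = c * csum D F.
Proof.
move=> Fs; rewrite /csum; case: c => a b.
have re i : D i -> `|Re (F i)| <= normc (F i) by move=> _; exact: Re_le_normc.
have im i : D i -> `|Im (F i)| <= normc (F i) by move=> _; exact: Im_le_normc.
have Z (w : I -> R) c : (forall i, D i -> `|w i| <= normc (F i)) ->
    forall i, D i -> `|c * w i| <= normc (c%:C * F i).
  move=> wF i Di; rewrite Normc.normcM normrM ler_pM// ?wF//=.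
  by rewrite expr0n addr0 sqrtr_sqr.
rewrite -[RHS]/(Complex (_ - _) (_ + _)).
rewrite -(rsumZ a re Fs) -(rsumZ b im Fs) -(rsumZ a im Fs) -(rsumZ b re Fs).
rewrite -rsumN.
rewrite -(rsumD (Z _ a re) (abs_summableZ _ Fs) (G := fun i => (- b)%:C * F i)); last 2 first.
- by move=> i Di; rewrite -mulNr; apply: Z im _ Di.
- exact: abs_summableZ.
rewrite -(rsumD (Z _ a im) (abs_summableZ _ Fs) (Z _ b re)); last exact: abs_summableZ.
by congr (_ +i* _); congr (rsum D _); apply/funext => i; case: (F i).
Qed.

Lemma eq_csum D F G : (forall i, D i -> F i = G i) -> csum D F = csum D G.
Proof.
move=> FG; rewrite /csum /rsum; congr (fine (_ - _)%E +i* fine (_ - _)%E);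
  by apply: eq_esum => i Di; rewrite ?funeposE ?funenegE /= FG.
Qed.

Lemma csum_supp1 D F i : (forall j, D j -> j != i -> F j = 0) ->
  csum D F = if i \in D then F i else 0.
Proof.
move=> F0; rewrite /csum !(@rsum_supp1 _ _ _ _ i); first by case: ifP => //; case: (F i).
  by move=> j Dj /(F0 _ Dj) ->.
by move=> j Dj /(F0 _ Dj) ->.
Qed.

Lemma csum_conj D F : csum D (fun i => (F i)^*) = (csum D F)^*.
Proof.
rewrite /csum -[RHS]/(Complex _ (- _)) -rsumN.
by congr (_ +i* _); congr (rsum D _); apply/funext => i; case: (F i).
Qed.

End Sums.

(** * Functionals on l^1 *)

Section Pairing.
Variables (R : realType) (T : choiceType).
Implicit Types (f g : l1 R T) (chi psi : T -> R[i]).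

Definition l1_norm f : R := fine (\esum_(t in setT) (normc (f t))%:E).

Definition bounded_fun (X : Type) (chi : X -> R[i]) :=
  exists C : R, forall x, normc (chi x) <= C.

(** The duality between l^1 and bounded functions. By [pairing_ext] it determines [f], so identities
    in l^1 can be checked on test functions. *)
Definition pairing f chi : R[i] := csum setT (fun t => f t * chi t).

Lemma l1_abs_summable f : abs_summable setT f.
Proof. exact/l1P/l1_summable. Qed.

Lemma l1_normE f : (l1_norm f)%:E = (\esum_(t in setT) (normc (f t))%:E)%E.
Proof.
rewrite fineK// ge0_fin_numE; first exact: l1_abs_summable.
by apply: esum_ge0 => t _; rewrite lee_fin normc_ge0.
Qed.

Lemma l1_norm_ge0 f : 0 <= l1_norm f.
Proof. by rewrite -lee_fin l1_normE esum_ge0// => t _; rewrite lee_fin normc_ge0. Qed.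

Lemma l1_ext f g : (forall t, f t = g t) -> f = g.
Proof. by move=> fg; apply/val_inj/funext. Qed.

Lemma l1_add f g t : (f + g) t = f t + g t. Proof. by []. Qed.
Lemma l1_opp f t : (- f) t = - f t. Proof. by []. Qed.
Lemma l1_scale (a : R[i]) f t : (a *: f) t = a * f t. Proof. by []. Qed.
Lemma l1_zero t : (0 : l1 R T) t = 0. Proof. by []. Qed.
Lemma l1_deltaE (s t : T) : l1_delta R s t = if t == s then 1 else 0. Proof. by []. Qed.

Lemma pairing_abs_summable f chi : bounded_fun chi ->
  abs_summable setT (fun t => f t * chi t).
Proof.
move=> [C chiC].
apply: (@le_abs_summable _ _ _ _ (fun t => (C%:C : R[i]) * f t)).
  move=> t _; rewrite !Normc.normcM mulrC ler_wpM2r ?normc_ge0//.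
  rewrite (le_trans (chiC t))//= expr0n addr0 sqrtr_sqr ler_norm//.
exact/abs_summableZ/l1_abs_summable.
Qed.

(** The factor 2 comes from [csum_le], which bounds real and imaginary parts separately; later
    estimates inherit it. *)
Lemma pairing_le f chi (C : R) : 0 <= C -> (forall t, normc (chi t) <= C) ->
  normc (pairing f chi) <= (C * l1_norm f) *+ 2.
Proof.
move=> C0 chiC; rewrite -lee_fin.
apply: (le_trans (csum_le _ _)); rewrite mulr2n EFinD.
suff H : (\esum_(t in setT) (normc (f t * chi t))%:E <= (C * l1_norm f)%:E)%E.
  exact: leeD.
rewrite EFinM l1_normE; apply: le_trans (esumZl_le _ C0 _).
  by apply: le_esum => t _; rewrite -EFinM lee_fin Normc.normcM mulrC ler_wpM2r ?normc_ge0.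
by move=> t; rewrite lee_fin normc_ge0.
Qed.

Lemma bounded_ge0 (X : Type) (chi : X -> R[i]) : bounded_fun chi ->
  exists2 C : R, 0 <= C & forall x, normc (chi x) <= C.
Proof.
move=> [C chiC]; exists `|C| => // x.
exact: le_trans (chiC x) (ler_norm C).
Qed.

Lemma pairingDZl (a : R[i]) f g chi : bounded_fun chi ->
  pairing (a *: f + g) chi = a * pairing f chi + pairing g chi.
Proof.
move=> chiB; have fs := pairing_abs_summable f chiB.
have gs := pairing_abs_summable g chiB.
rewrite /pairing -csumZ// -csumD//; last exact: abs_summableZ.
by apply: eq_csum => t _; rewrite l1_add l1_scale mulrDl mulrA.
Qed.

Lemma pairingDZr (a : R[i]) f chi psi : bounded_fun chi -> bounded_fun psi ->
  pairing f (fun t => a * chi t + psi t) = a * pairing f chi + pairing f psi.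
Proof.
move=> chiB psiB; have fs := pairing_abs_summable f chiB.
have gs := pairing_abs_summable f psiB.
rewrite /pairing -csumZ// -csumD//; last exact: abs_summableZ.
by apply: eq_csum => t _; rewrite mulrDr mulrCA.
Qed.

Lemma eq_pairing f chi psi : (forall t, f t != 0 -> chi t = psi t) ->
  pairing f chi = pairing f psi.
Proof.
move=> E; apply: eq_csum => t _.
by have [->|/E->//] := eqVneq (f t) 0; rewrite !mul0r.
Qed.

Lemma pairing_delta s chi : pairing (l1_delta R s) chi = chi s.
Proof.
rewrite /pairing (@csum_supp1 _ _ _ _ s) ?mem_set//=; first by rewrite eqxx mul1r.
by move=> t _ /negPf ts; rewrite ts mul0r.
Qed.

Lemma pairing_indic f s : pairing f (fun t => if t == s then 1 else 0) = f s.
Proof.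
rewrite /pairing (@csum_supp1 _ _ _ _ s) ?mem_set//=; first by rewrite eqxx mulr1.
by move=> t _ /negPf ts; rewrite ts mulr0.
Qed.

Lemma bounded_indic (X : Type) (P : X -> bool) :
  bounded_fun (fun t => if P t then 1 else 0).
Proof. by exists 1 => t; case: ifP => _; rewrite ?Normc.normc1 ?Normc.normc0. Qed.

Lemma l1_norm_ub f t : normc (f t) <= l1_norm f.
Proof.
rewrite -lee_fin l1_normE (esumID [set t])//; last first.
  by move=> s _; rewrite lee_fin normc_ge0.
rewrite setTI esum_set1 ?lee_fin ?normc_ge0//.
by rewrite leeDl// esum_ge0// => s _; rewrite lee_fin normc_ge0.
Qed.

Lemma bounded_l1 f : bounded_fun f.
Proof. by exists (l1_norm f) => t; exact: l1_norm_ub. Qed.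

(** The norm is a supremum over finite sets, and deleting a nearly optimal one leaves a small
    remainder. That the remainder agrees with [f] off the finite set is what [supp_countable]
    uses. *)
Lemma l1_norm_finite_approx f (e : R) : 0 < e ->
  exists2 s : seq T,
    forall t, t \notin s -> (f - \sum_(r <- s) f r *: l1_delta R r) t = f t &
    l1_norm (f - \sum_(t <- s) f t *: l1_delta R t) < e.
Proof.
move=> e0.
have : ((l1_norm f - e)%:E < \esum_(t in setT) (normc (f t))%:E)%E.
  by rewrite -l1_normE lte_fin ltrBlDr ltrDl.
move=> /ereal_sup_gt[_ [F [finF _] <-]]; rewrite fsbig_finite//= => lt.
pose g := f - \sum_(r <- finmap.enum_fset (fset_set F)) f r *: l1_delta R r.
have gE t : g t = if t \in fset_set F then 0 else f t.
  have sumE (s : seq T) : (\sum_(t <- s) f t *: l1_delta R t) t =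
      \sum_(r <- s) f r * (if t == r then 1 else 0).
    elim: s => [|r s IH]; first by rewrite !big_nil.
    by rewrite !big_cons l1_add IH.
  rewrite /g l1_add l1_opp sumE; case: ifPn => tF.
    rewrite (big_fsetD1 t)//= eqxx mulr1 big1_fset ?addr0 ?subrr// => r.
    by rewrite !inE => /andP[/negPf rt _] _; rewrite eq_sym rt mulr0.
  rewrite big1_fset ?subr0// => r rF _; case: eqP => [E|_]; last by rewrite mulr0.
  by rewrite E rF in tF.
exists (finmap.enum_fset (fset_set F)).
  by move=> t /negPf tF; apply: etrans (gE t) _; rewrite tF.
rewrite -/g -lte_fin l1_normE.
move: lt; rewrite -fsbig_finite// -esum_fset//; last first.
  by move=> t _; rewrite lee_fin normc_ge0.
have gFin : (\esum_(t in F) (normc (f t))%:E + \esum_(t in setT) (normc (g t))%:E =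
    (l1_norm f)%:E)%E.
  rewrite l1_normE (esumID F setT (fun t => (normc (f t))%:E)); last first.
    by move=> t _; rewrite lee_fin normc_ge0.
  rewrite setTI setTI (esumID F setT (fun t => (normc (g t))%:E)); last first.
    by move=> t _; rewrite lee_fin normc_ge0.
  rewrite !setTI; congr (_ + _)%E.
  rewrite [X in (X + _)%E]esum1 ?add0e; last first.
    by move=> t Ft; rewrite gE in_fset_set// mem_set// Normc.normc0.
  by apply: eq_esum => t Ft; rewrite gE in_fset_set// memNset.
move: gFin; rewrite -l1_normE; set a := esum F _.
have : (0 <= a)%E by apply: esum_ge0 => t _; rewrite lee_fin normc_ge0.
by case: a => [a||] //= _ /eqP; rewrite -EFinD eqe !lte_fin => /eqP; lra.
Qed.

(** Finite combinations of point masses are dense and [L] is continuous. Identities between iterated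
    sums are reduced to point masses in this way. *)
Lemma l1_density (L : l1 R T -> R[i]) (C : R) :
  (forall a f g, L (a *: f + g) = a * L f + L g) ->
  (forall f, normc (L f) <= C * l1_norm f) ->
  (forall t, L (l1_delta R t) = 0) -> forall f, L f = 0.
Proof.
move=> lin bnd L0 f; apply: Normc.eq0_normc; apply/le_anti.
rewrite normc_ge0 andbT; apply/ler_addgt0Pr => e e0; rewrite add0r.
have C1 : 0 < `|C| + 1 by rewrite ltr_wpDl.
(* [C] may be zero or negative, hence the tolerance e / (|C| + 1). *)
have [s _ sP] := l1_norm_finite_approx f (divr_gt0 e0 C1).
have -> : L f = L (f - \sum_(t <- s) f t *: l1_delta R t).
  have L00 : L 0 = 0 by have := lin (-1) 0 0; rewrite scaler0 addr0 mulN1r addNr.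
  have Ls : L (\sum_(t <- s) f t *: l1_delta R t) = 0.
    elim: s {sP} => [|t s IH]; first by rewrite big_nil.
    by rewrite big_cons lin L0 mulr0 add0r IH.
  by rewrite addrC -scaleN1r lin Ls mulr0 add0r.
apply: le_trans (bnd _) _; apply: le_trans (ler_wpM2r (l1_norm_ge0 _) (ler_norm C)) _.
apply: (@le_trans _ _ ((`|C| + 1) * (e / (`|C| + 1)))).
  by apply: ler_pM => //; [exact: l1_norm_ge0|rewrite lerDl|exact: ltW].
by rewrite mulrCA divff ?mulr1// gt_eqF.
Qed.

Lemma l1_norm_delta t : l1_norm (l1_delta R t) = 1.
Proof.
apply/EFin_inj; rewrite l1_normE (esumID [set t])//; last first.
  by move=> s _; rewrite lee_fin normc_ge0.
rewrite setTI esum_set1 ?lee_fin ?normc_ge0// l1_deltaE eqxx Normc.normc1.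
rewrite esum1 ?adde0// => s /= [_ /eqP/negPf st].
by rewrite st Normc.normc0.
Qed.

Lemma l1_norm_le f (C : R) : (\esum_(t in setT) (normc (f t))%:E <= C%:E)%E ->
  l1_norm f <= C.
Proof. by rewrite -lee_fin l1_normE. Qed.

(** For each [n] the modulus is at most 1 / (n + 1) outside a finite set; a point outside all these
    sets carries the value 0. *)
Lemma supp_countable f : countable (supp f).
Proof.
have e0 n : (0 : R) < n.+1%:R^-1 by rewrite invr_gt0.
have ex n : exists s : seq T, forall t, t \notin s -> normc (f t) <= n.+1%:R^-1.
  have [s sE sP] := l1_norm_finite_approx f (e0 n); exists s => t /sE <-.
  exact: le_trans (l1_norm_ub _ t) (ltW sP).
have [s sP] := choice ex.
apply: (@sub_countable _ _ _ (\bigcup_n [set` s n])); last first.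
  by apply: bigcup_countable => // n _; exact/finite_set_countable/finite_seq.
apply: subset_card_le => t; rewrite /supp /= => ft; apply: contrapT => nt.
have le n : normc (f t) <= n.+1%:R^-1.
  by apply: sP; apply/negP => ts; apply: nt; exists n.
have f0 : 0 < normc (f t).
  by rewrite lt_neqAle normc_ge0 andbT; apply: contra_neq ft => /esym/Normc.eq0_normc.
have := archi_boundP (ltW (divr_gt0 ltr01 f0)); set n := Num.bound _ => lt.
move: lt (le n); rewrite ltr_pdivrMr// -[n.+1%:R^-1]mul1r ler_pdivlMr// -natr1.
by set x : R := n%:R; nra.
Qed.

End Pairing.

(** * Convolution as a bilinear associative product, through test functions *)

Section ConvolutionTheory.
Variables (R : realType) (T : semigroupType).
Implicit Types (f g h : l1 R T) (chi : T -> R[i]).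

Lemma l1_prod_summable f g :
  (\esum_(rs in [set: T * T]) (normc (f rs.1 * g rs.2))%:E <=
   (l1_norm f * l1_norm g)%:E)%E.
Proof.
rewrite -setXTT -(@esum_esum _ _ _ setT (fun=> setT)
  (fun r s => (normc (f r * g s))%:E)); last first.
  by move=> r s _ _; rewrite lee_fin normc_ge0.
apply: (@le_trans _ _ (\esum_(r in setT) ((l1_norm g)%:E * (normc (f r))%:E))%E).
  apply: le_esum => r _; rewrite l1_normE muleC.
  apply: le_trans (esumZl_le _ _ _).
  - by apply: le_esum => s _; rewrite Normc.normcM EFinM.
  - exact: normc_ge0.
  - by move=> s; rewrite lee_fin normc_ge0.
apply: le_trans (esumZl_le _ _ _) _.
- exact: l1_norm_ge0.
- by move=> s; rewrite lee_fin normc_ge0.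
by rewrite -l1_normE -EFinM mulrC.
Qed.

Lemma l1_prod_abs_summable f g (D : set (T * T)) :
  abs_summable D (fun rs => f rs.1 * g rs.2).
Proof.
apply: le_lt_trans (le_lt_trans (l1_prod_summable f g) (ltry _)).
rewrite [leRHS](esumID D)//; last by move=> rs _; rewrite lee_fin normc_ge0.
rewrite setTI leeDl// esum_ge0// => rs _; by rewrite lee_fin normc_ge0.
Qed.

Lemma conv_norm_le f g : l1_norm (f \star g) <= (l1_norm f * l1_norm g) *+ 2.
Proof.
apply: l1_norm_le.
pose J (t : T) := [set rs : T * T | (rs.1 * rs.2)%g = t].
have H : (\esum_(t in setT) \esum_(rs in J t) (normc (f rs.1 * g rs.2))%:E <=
    (l1_norm f * l1_norm g)%:E)%E.
  rewrite (@esum_esum _ _ _ _ J (fun _ rs => (normc (f rs.1 * g rs.2))%:E))//=;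
    last by move=> t rs _ _; rewrite lee_fin normc_ge0.
  rewrite (reindex_esum setT _ (fun rs : T * T => ((rs.1 * rs.2)%g, rs)))//=.
    exact: l1_prod_summable.
  split=> [rs _//|rs1 rs2 _ _ [_ ->//]|[t rs] /= [_ <-]]; by exists rs.
apply: (@le_trans _ _ (\esum_(t in setT)
   (\esum_(rs in J t) (normc (f rs.1 * g rs.2))%:E +
    \esum_(rs in J t) (normc (f rs.1 * g rs.2))%:E))%E).
  by apply: le_esum => t _; exact: csum_le.
have e0 t : (0 <= \esum_(rs in J t) (normc (f rs.1 * g rs.2))%:E)%E.
  by apply: esum_ge0 => rs _; rewrite lee_fin normc_ge0.
by rewrite esumD// mulr2n EFinD; apply: leeD.
Qed.

Lemma convDZl (a : R[i]) f g h : (a *: f + g) \star h = a *: (f \star h) + g \star h.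
Proof.
apply: l1_ext => t; rewrite l1_add l1_scale /=.
have fs := l1_prod_abs_summable f h; have gs := l1_prod_abs_summable g h.
rewrite -csumZ// -csumD//; last exact: abs_summableZ.
by apply: eq_csum => rs _; rewrite l1_add l1_scale mulrDl mulrA.
Qed.

Lemma convDZr (a : R[i]) f g h : h \star (a *: f + g) = a *: (h \star f) + h \star g.
Proof.
apply: l1_ext => t; rewrite l1_add l1_scale /=.
have fs := l1_prod_abs_summable h f; have gs := l1_prod_abs_summable h g.
rewrite -csumZ// -csumD//; last exact: abs_summableZ.
by apply: eq_csum => rs _; rewrite l1_add l1_scale mulrDr mulrCA.
Qed.

Lemma convDl f g h : (f + g) \star h = f \star h + g \star h.
Proof. by have := convDZl 1 f g h; rewrite !scale1r. Qed.
Lemma convDr f g h : h \star (f + g) = h \star f + h \star g.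
Proof. by have := convDZr 1 f g h; rewrite !scale1r. Qed.
Lemma conv0l h : 0 \star h = 0.
Proof. by apply: (addrI (0 \star h)); rewrite -convDl !addr0. Qed.
Lemma conv0r h : h \star 0 = 0.
Proof. by apply: (addrI (h \star 0)); rewrite -convDr !addr0. Qed.
Lemma convZl (a : R[i]) f h : (a *: f) \star h = a *: (f \star h).
Proof. by have := convDZl a f 0 h; rewrite conv0l !addr0. Qed.
Lemma convZr (a : R[i]) f h : h \star (a *: f) = a *: (h \star f).
Proof. by have := convDZr a f 0 h; rewrite conv0r !addr0. Qed.
Lemma normcB_le (z w : R[i]) (a b : R) : normc z <= a -> normc w <= b ->
  normc (z - w) <= a + b.
Proof.
move=> za wb; apply: le_trans (le_normcD _ _) (lerD za _).
by case: w wb => x y /=; rewrite !sqrrN.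
Qed.

Lemma bounded_pairing (X : Type) (T' : choiceType) (F : X -> l1 R T')
    (k : X -> T' -> R[i]) (C D : R) : 0 <= C -> 0 <= D ->
  (forall x, l1_norm (F x) <= D) -> (forall x t, normc (k x t) <= C) ->
  bounded_fun (fun x => pairing (F x) (k x)).
Proof.
move=> C0 D0 FD kC; exists ((C * D) *+ 2) => x.
apply: le_trans (pairing_le _ C0 (kC x)) _.
by rewrite lerMn2r/= ler_wpM2l.
Qed.

(** Fubini for a bounded kernel: both sides are bounded linear functionals of [f] that agree on
    point masses. *)
Lemma pairing_swap (X Y : choiceType) (f : l1 R X) (g : l1 R Y) (k : X -> Y -> R[i]) :
  bounded_fun (fun xy => k xy.1 xy.2) ->
  pairing f (fun x => pairing g (k x)) = pairing g (fun y => pairing f (k^~ y)).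
Proof.
move=> /bounded_ge0[C C0 kC].
have kC1 x y : normc (k x y) <= C := kC (x, y).
have b1 x : bounded_fun (k x) by exists C.
have b2 y : bounded_fun (k^~ y) by exists C.
have b3 (g' : l1 R Y) : bounded_fun (fun x => pairing g' (k x)).
  exact: (@bounded_pairing _ _ (fun=> g') k C _ C0 (l1_norm_ge0 g') (fun=> lexx _)).
have b4 (f' : l1 R X) : bounded_fun (fun y => pairing f' (k^~ y)).
  by apply: (@bounded_pairing _ _ (fun=> f') (fun y x => k x y) C _ C0 (l1_norm_ge0 f') (fun=> lexx _)).
apply/eqP; rewrite -subr_eq0; apply/eqP; move: f.
have n0 (Z : choiceType) (z : l1 R Z) := l1_norm_ge0 z.
apply: (@l1_density _ _ _ ((C * l1_norm g) *+ 2 *+ 2 + ((C *+ 2) * l1_norm g) *+ 2)).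
- move=> a f f'; rewrite pairingDZl//.
  rewrite [X in _ - X](eq_pairing (psi := fun y => a * pairing f (k^~ y) + pairing f' (k^~ y))); last first.
    by move=> y _; rewrite pairingDZl.
  rewrite pairingDZr//; ring.
- move=> f; rewrite mulrDl; apply: normcB_le.
    rewrite mulrnAl; apply: pairing_le; first by rewrite mulrn_wge0// mulr_ge0.
    by move=> x; exact: pairing_le.
  rewrite mulrnAl [_ *+ 2 * _ * _]mulrAC; apply: pairing_le.
    by rewrite mulr_ge0// mulrn_wge0.
  by move=> y; rewrite mulrnAl; apply: pairing_le.
- move=> x; rewrite pairing_delta.
  rewrite (eq_pairing (psi := k x)) ?subrr// => y _; exact: pairing_delta.
Qed.

(** By density in [f] and then in [g], it is enough to convolve two point masses. This replaces sums
    over the fibres of the product by iterated sums over all of [T]. *)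
Lemma pairing_conv f g chi : bounded_fun chi ->
  pairing (f \star g) chi = pairing f (fun r => pairing g (fun s => chi (r * s)%g)).
Proof.
move=> /[dup] chiB /bounded_ge0[C C0 chiC].
have n0 (z : l1 R T) := l1_norm_ge0 z.
have b1 r : bounded_fun (fun s => chi (r * s)%g) by exists C.
have b2 (g' : l1 R T) : bounded_fun (fun r => pairing g' (fun s => chi (r * s)%g)).
  by apply: (@bounded_pairing _ _ (fun=> g') (fun r s => chi (r * s)%g) C _ C0 (n0 g') (fun=> lexx _)).
apply/eqP; rewrite -subr_eq0; apply/eqP; move: f.
apply: (@l1_density _ _ _ (C * l1_norm g *+ 2 *+ 2 + C * l1_norm g *+ 2 *+ 2)).
- move=> a f f'; rewrite convDZl !pairingDZl//; ring.
- move=> f; rewrite mulrDl; apply: normcB_le.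
    apply: le_trans (pairing_le _ C0 chiC) _.
    rewrite !mulrnAl lerMn2r/= -mulrA -mulrnAr ler_wpM2l// mulrC.
    exact: conv_norm_le.
  rewrite mulrnAl; apply: pairing_le; first by rewrite mulrn_wge0// mulr_ge0.
  by move=> x; exact: pairing_le.
move=> r; rewrite pairing_delta; move: g b2.
move=> g _; move: g.
apply: (@l1_density _ _ _ (C *+ 2 *+ 2 + C *+ 2)).
- move=> a g g'; rewrite convDZr !pairingDZl//; ring.
- move=> g; rewrite mulrDl; apply: normcB_le.
    apply: le_trans (pairing_le _ C0 chiC) _.
    rewrite !mulrnAl lerMn2r/= -mulrnAr ler_wpM2l//.
    by have := conv_norm_le (l1_delta R r) g; rewrite l1_norm_delta mul1r.
  by rewrite mulrnAl; apply: pairing_le.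
by move=> s; rewrite l1_deltaM !pairing_delta subrr.
Qed.

Lemma bounded_kernel (X : choiceType) (f : l1 R X) (Y : Type) (k : X -> Y -> R[i]) :
  bounded_fun (fun xy => k xy.1 xy.2) -> bounded_fun (fun y => pairing f (k^~ y)).
Proof.
move=> /bounded_ge0[C C0 kC].
by apply: (@bounded_pairing _ _ (fun=> f) (fun y x => k x y) C _ C0 (l1_norm_ge0 f) (fun=> lexx _)) => y x; exact: (kC (x, y)).
Qed.

Lemma pairing_ext (X : choiceType) (f g : l1 R X) :
  (forall chi : X -> R[i], bounded_fun chi -> pairing f chi = pairing g chi) -> f = g.
Proof.
by move=> fg; apply: l1_ext => t; rewrite -!pairing_indic fg//; exact: bounded_indic.
Qed.

Lemma convA f g h : f \star (g \star h) = f \star g \star h.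
Proof.
apply: pairing_ext => chi /[dup] chiB [C chiC].
rewrite !pairing_conv//; last first.
  by apply: (@bounded_kernel _ h _ (fun s r => chi (r * s)%g)); exists C.
apply: eq_pairing => r _; rewrite pairing_conv; last by exists C.
by apply: eq_pairing => s _; apply: eq_pairing => t _; rewrite mulgA.
Qed.

Lemma conv_comm f g : (forall r t, f r != 0 -> g t != 0 -> (r * t = t * r)%g) ->
  f \star g = g \star f.
Proof.
move=> fgC; apply: pairing_ext => chi /[dup] chiB [C chiC]; rewrite !pairing_conv//.
rewrite pairing_swap; last by exists C => xy; exact: chiC.
by apply: eq_pairing => t gt; apply: eq_pairing => r fr; rewrite fgC.
Qed.

End ConvolutionTheory.

(** * The Jacobson radical *)

Section JacobsonRadicalTheory.
Variables (K : fieldType) (A : lmodType K) (m : A -> A -> A) (E : A).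
Hypothesis mA : associative m.
Hypothesis mDZl : forall (a : K) x y z, m (a *: x + y) z = a *: m x z + m y z.
Hypothesis mDZr : forall (a : K) x y z, m z (a *: x + y) = a *: m z x + m z y.
Hypothesis mEl : forall x, m E x = x.
Hypothesis mEr : forall x, m x E = x.

Lemma left_idealD (I : set A) x y : left_ideal m I -> I x -> I y -> I (x + y).
Proof. by move=> [_ IDZ _] Ix Iy; rewrite -[x]scale1r; exact: IDZ. Qed.

Lemma left_ideal_unit (I : set A) : left_ideal m I -> I E -> I = setT.
Proof.
by move=> [_ _ Im] IE; apply/seteqP; split=> // x _; rewrite -(mEr x); exact: Im.
Qed.

(** Zorn's lemma for the left ideals that contain [I] and miss [E]. A maximal one is maximal among
    all proper left ideals, since a left ideal containing [E] is everything. *)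
Lemma maximal_left_ideal_exists (I : set A) : left_ideal m I -> ~ I E ->
  exists2 M, maximal_left_ideal m M & I `<=` M.
Proof.
move=> Ii IE.
pose P := [set X : set A | X = set0 \/ [/\ left_ideal m X, I `<=` X & ~ X E]].
have [F FP Ftot|M [[M0|[Mi IM ME]] Mmax]] := @Zorn_bigcup A P.
- have [F0|] := pselect (forall X, F X -> X = set0).
    by left; apply/seteqP; split=> // x [X /F0 ->].
  move=> /existsNP[X0 /not_implyP[FX0 X00]]; right.
  have [//|[X0i IX0 _]] := FP _ FX0.
  split; last by move=> [X FX XE]; have [X0'|[_ _ //]] := FP _ FX; rewrite X0' in XE.
    split=> [|a x y [X FX Xx] [Y FY Yy]|x y [X FX Xx]].
    + by exists X0 => //; case: X0i.
    + have [XY|YX] := Ftot _ _ FX FY.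
        exists Y => //; have [Y0|[[_ YDZ _] _ _]] := FP _ FY; first by rewrite Y0 in Yy.
        by apply: YDZ => //; exact: XY.
      exists X => //; have [Y0|[[_ YDZ _] _ _]] := FP _ FX; first by rewrite Y0 in Xx.
      by apply: YDZ => //; exact: YX.
    + exists X => //; have [X0'|[[_ _ Xm] _ _]] := FP _ FX; first by rewrite X0' in Xx.
      exact: Xm.
  by move=> x /IX0 X0x; exists X0.
- exfalso; apply: (Mmax I); last by right; split.
  rewrite M0; split=> // I0; have [/I0 //] := Ii.
- exists M => //; split=> // [MT|J Ji MJ]; first by apply: ME; rewrite MT.
  have [JE|JE] := pselect (J E); first by right; exact: left_ideal_unit.
  left; apply: contrapT => JM; apply: (Mmax J).
    by split=> // JM'; apply: JM; apply/seteqP; split.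
  by right; split=> //; exact: subset_trans MJ.
Qed.

(** The left ideal generated by [E - z] contains [E]: otherwise it lies in a maximal left ideal,
    which contains [z] too and hence [E]. *)
Lemma maximal_left_ideals_left_inverse z :
  (forall M, maximal_left_ideal m M -> M z) -> exists y, m y (E - z) = E.
Proof.
move=> zM; pose I := [set m y (E - z) | y in setT].
have Ii : left_ideal m I.
  have m0 x : m 0 x = 0 by have := mDZl (-1) 0 0 x; rewrite !scaleN1r oppr0 addr0 addNr.
  split=> [|a _ _ [x _ <-] [y _ <-]|x _ [y _ <-]].
  - by exists 0.
  - by exists (a *: x + y).
  - by exists (m x y) => //; rewrite mA.
have [[y _ yE]|IE] := pselect (I E); first by exists y.
have [M Mm IM] := maximal_left_ideal_exists Ii IE.
have [Mi MT _] := Mm; exfalso; apply/MT/(left_ideal_unit Mi).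
rewrite -(subrK z E); apply: left_idealD (zM _ Mm) => //.
by apply: IM; exists E.
Qed.

(** If [z] were outside [M], then [E = w + y] with [w = m x z] and [y] in [M]. As the cube of [w]
    vanishes, [y = E - w] has the left inverse [E + w + m w w], which puts [E] in [M]. *)
Lemma nilpotent_maximal_left_ideal z M :
  (forall x, let w := m x z in m (m w w) w = 0) -> maximal_left_ideal m M -> M z.
Proof.
move=> nil [Mi MT Mmax]; apply: contrapT => Mz.
pose I := [set m x z + y | x in setT & y in M].
have [M0 MDZ Mm] := Mi.
have Ii : left_ideal m I.
  have m0 x : m 0 x = 0 by have := mDZl (-1) 0 0 x; rewrite !scaleN1r oppr0 addr0 addNr.
  split=> [|a _ _ [x _ [y My <-]] [x' _ [y' My' <-]]|x _ [x' _ [y' My' <-]]].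
  - by exists 0 => //; exists 0 => //; rewrite m0 addr0.
  - exists (a *: x + x') => //; exists (a *: y + y'); first exact: MDZ.
    by rewrite mDZl scalerDr addrACA.
  - exists (m x x') => //; exists (m x y'); first exact: Mm.
    by rewrite -[m x' z]scale1r mDZr scale1r mA.
have IzE : I z by exists E => //; exists 0 => //; rewrite mEl addr0.
have MI : M `<=` I.
  move=> y My; exists 0 => //; exists y => //.
  by have := mDZl (-1) 0 0 z; rewrite !scaleN1r oppr0 addr0 addNr => ->; rewrite add0r.
have [IM|IT] := Mmax I Ii MI; first by apply: Mz; rewrite -IM.
have : I E by rewrite IT.
move=> [x _ [y My xyE]]; set w := m x z in xyE; have w3 := nil x.
rewrite /= -/w in w3; apply/MT/(left_ideal_unit Mi).
have mB u v : m u (E - v) = u - m u v.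
  by rewrite addrC -scaleN1r mDZr mEr scaleN1r addrC.
have yE : y = E - w by rewrite -xyE addrC addKr.
suff -> : E = E - w + m w (E - w) + m (m w w) (E - w).
  by rewrite -yE; do 2 (apply: (left_idealD Mi); last exact: Mm).
by rewrite !mB w3 subr0 addrA !subrK.
Qed.

End JacobsonRadicalTheory.

Section JacobsonRadicalAlgebra.
Variables (K : fieldType) (A : lmodType K) (m : A -> A -> A).
Hypothesis mA : associative m.
Hypothesis mDZl : forall (a : K) x y z, m (a *: x + y) z = a *: m x z + m y z.
Hypothesis mDZr : forall (a : K) x y z, m z (a *: x + y) = a *: m z x + m z y.

Let mDl x y z : m (x + y) z = m x z + m y z.
Proof. by have := mDZl 1 x y z; rewrite !scale1r. Qed.
Let mDr x y z : m z (x + y) = m z x + m z y.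
Proof. by have := mDZr 1 x y z; rewrite !scale1r. Qed.
Let m0l z : m 0 z = 0.
Proof. by apply: (addrI (m 0 z)); rewrite -mDl !addr0. Qed.
Let m0r z : m z 0 = 0.
Proof. by apply: (addrI (m z 0)); rewrite -mDr !addr0. Qed.
Let mZl (a : K) x z : m (a *: x) z = a *: m x z.
Proof. by have := mDZl a x 0 z; rewrite m0l !addr0. Qed.
Let mZr (a : K) x z : m z (a *: x) = a *: m z x.
Proof. by have := mDZr a x 0 z; rewrite m0r !addr0. Qed.

Lemma unitizationA : associative (unitization m).
Proof.
move=> [a x] [b y] [c z]; rewrite /unitization /=; congr pair; first exact: mulrA.
rewrite !mDl !mDr !mZl !mZr !scalerDr !scalerA mA mulrC -!addrA.
congr (_ + _); rewrite [a * c]mulrC; congr (_ + _).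
rewrite [c * b]mulrC addrCA; congr (_ + _).
by rewrite [RHS]addrCA; congr (_ + _); rewrite addrCA.
Qed.

Lemma unitizationDZl (a : K) u v w :
  unitization m (a *: u + v) w = a *: unitization m u w + unitization m v w.
Proof.
case: u v w => [a1 x] [a2 y] [a3 z]; rewrite /unitization /=; congr pair.
  by rewrite mulrDl -scalerAl.
rewrite /= -[a *: a1]/(a * a1) mDl mZl !scalerDr scalerDl !scalerA [a3 * a]mulrC.
by rewrite [RHS]addrACA; congr (_ + _); exact: addrACA.
Qed.

Lemma unitizationDZr (a : K) u v w :
  unitization m w (a *: u + v) = a *: unitization m w u + unitization m w v.
Proof.
case: u v w => [a1 x] [a2 y] [a3 z]; rewrite /unitization /=; congr pair.
  by rewrite mulrDr -scalerAr.
rewrite /= -[a *: a1]/(a * a1) mDr mZr !scalerDr scalerDl !scalerA [a3 * a]mulrC.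
by rewrite [RHS]addrACA; congr (_ + _); exact: addrACA.
Qed.

Lemma unitization1l u : unitization m (1, 0) u = u.
Proof. by case: u => [a x]; rewrite /unitization /= mul1r scale1r scaler0 addr0 m0l addr0. Qed.

Lemma unitization1r u : unitization m u (1, 0) = u.
Proof. by case: u => [a x]; rewrite /unitization /= mulr1 scale1r scaler0 add0r m0r addr0. Qed.

(** If there is an identity [E], subtract it from a left inverse of [E - m x f]. Otherwise the left
    inverse of [(1, - m x f)] in the unitization has first coordinate 1, and its second coordinate
    is the quasi-inverse. The conclusion thus no longer mentions an identity. *)
Lemma jacobson_left_quasi_inverse f x : jacobson_radical m f ->
  exists g, g = m x f + m g (m x f).
Proof.
move=> [Jid Junit]; have [[E EP]|nE] := pselect (has_identity m).
  have [|||y yE] := @maximal_left_ideals_left_inverse K A m E mA mDZl _ _ (m x f).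
  - by move=> z; case: (EP z).
  - by move=> z; case: (EP z).
  - move=> M Mm; have := Jid (ex_intro _ E EP) M Mm; case: Mm => -[_ _ Mm] _ _.
    exact: Mm.
  have yE' : y - m y (m x f) = E.
    by rewrite -[RHS]yE -[- m x f]scaleN1r mDr mZr (proj2 (EP y)) scaleN1r.
  exists (y - E); rewrite mDl -[- E]scaleN1r mZl (proj1 (EP _)) !scaleN1r.
  by rewrite [RHS]addrC subrK -[in LHS]yE' opprB addrC subrK.
have [|||[a y] yE] := @maximal_left_ideals_left_inverse K (K^o * A)%type (unitization m)
  (1, 0) unitizationA unitizationDZl _ _ (0, m x f).
- exact: unitization1l.
- exact: unitization1r.
- move=> M Mm; have := Junit nE M Mm; case: Mm => -[_ _ Mm] _ _ /(Mm (0, x)).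
  by rewrite /unitization /= mul0r !scale0r !add0r.
exists y; move: yE; rewrite /unitization /= => -[].
rewrite -/(GRing.add _ _) /= subr0 mulr1 => -> /eqP.
rewrite !scale1r sub0r -[- m x f]scaleN1r mZr !scaleN1r.
by rewrite [- m x f + y]addrC -addrA -opprD subr_eq0 => /eqP.
Qed.

(** The scalar [a] is there for the unitization, where [(a, x)] times [(0, f)] is
    [(0, a *: f + m x f)]; the case [a = 0] serves an algebra with identity. *)
Lemma nilpotent_jacobson f :
  (forall (a : K) x, let w := a *: f + m x f in m (m w w) w = 0) ->
  jacobson_radical m f.
Proof.
move=> nil; split=> [[E EP] M|_ M].
  apply: (@nilpotent_maximal_left_ideal K A m E) => //.
  - by move=> z; case: (EP z).
  - by move=> z; case: (EP z).
  - by move=> x /=; have := nil 0 x; rewrite scale0r add0r.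
apply: (@nilpotent_maximal_left_ideal K (K^o * A)%type (unitization m) (1, 0)).
- exact: unitizationA.
- exact: unitizationDZl.
- exact: unitizationDZr.
- exact: unitization1l.
- exact: unitization1r.
move=> [a x] /=; have := nil a x.
by rewrite /= /unitization /= !mulr0 !scale0r !add0r ?addr0 => ->.
Qed.

End JacobsonRadicalAlgebra.

(** * The algebra l^1 of a group *)

(** The ratios of consecutive terms do not decrease, and the first of them is [a 1]. *)
Lemma geometric_of_log_convex (R : realType) (a : nat -> R) : a 0%N = 1 -> 0 < a 1%N ->
  (forall n, 0 <= a n) -> (forall n, a n.+1 ^+ 2 <= a n * a n.+2) ->
  forall n, 0 < a n /\ a 1%N * a n <= a n.+1.
Proof.
move=> a0 a1 age lc; elim=> [|n [an IH]]; first by rewrite a0 mulr1.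
have an1 : 0 < a n.+1 by apply: lt_le_trans IH; exact: mulr_gt0.
split=> //; rewrite -(ler_pM2l an); apply: le_trans (lc n).
by rewrite mulrA expr2 ler_pM2r// mulrC.
Qed.

(** Log-convexity makes the ratios of consecutive terms increase. Hence a bound at even indices
    bounds them all, and a ratio at [n] close to their supremum [M] is still as close at [n.*2]. *)
Lemma log_convex_sup_ratio (R : realType) (a : nat -> R) (C : R) : (forall n, 0 < a n) ->
  (forall n, a n.+1 ^+ 2 <= a n * a n.+2) ->
  (forall n, a n.*2.+1 <= C * a n.*2) ->
  exists2 M, 0 < M & (forall n, a n.+1 <= M * a n) /\
    forall d : R, d < M -> exists n, d * a n.*2 < a n.*2.+1.
Proof.
move=> a0 lc aC; pose r n := a n.+1 / a n.
have r0 n : 0 < r n by rewrite divr_gt0.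
have rS n : r n <= r n.+1.
  rewrite /r ler_pdivrMr// mulrAC ler_pdivlMr// -expr2 mulrC; exact: lc.
have rmono m n : (m <= n)%N -> r m <= r n.
  by move=> /subnK <-; elim: (n - m)%N => // k IH; apply: le_trans IH (rS _).
have rC n : r n <= C.
  apply: (@le_trans _ _ (r n.*2)); first by apply: rmono; rewrite -addnn leq_addr.
  by rewrite /r ler_pdivrMr.
have rsup : has_sup (range r) by split; [exists (r 0%N), 0%N|exists C => _ [n _ <-]].
have ub n : r n <= sup (range r) by apply: sup_upper_bound => //; exists n.
exists (sup (range r)); first exact: lt_le_trans (r0 0%N) (ub 0%N).
split=> [n|d dM]; first by rewrite -ler_pdivrMr; [exact: ub|].
have [_ [n _ <-] dn] := sup_adherent (eps := sup (range r) - d) (ltac:(lra)) rsup.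
exists n; rewrite -ltr_pdivlMr//; apply: (@lt_le_trans _ _ (r n)).
  by move: dn; rewrite subKr.
by apply: rmono; rewrite -addnn leq_addr.
Qed.

Lemma csum_reindex (R : realType) (I J : choiceType) (P : set I) (Q : set J)
    (j : I -> J) (F : J -> R[i]) : set_bij P Q j ->
  csum Q F = csum P (F \o j).
Proof.
by move=> jb; rewrite /csum /rsum; congr (fine (_ - _)%E +i* fine (_ - _)%E);
  rewrite (reindex_esum P Q j _ jb); apply: eq_esum => i _;
  rewrite ?funeposE ?funenegE.
Qed.

Lemma conjcM (R : rcfType) (z w : R[i]) : conjc (z * w) = conjc z * conjc w.
Proof. exact: rmorphM. Qed.

Section GroupAlgebra.
Variables (R : realType) (T : semigroupType) (G : set T) (e : T) (inv : T -> T).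
Hypothesis Ge : G e.
Hypothesis GM : forall x y, G x -> G y -> G (x * y)%g.
Hypothesis Gel : forall x, G x -> (e * x)%g = x.
Hypothesis Ger : forall x, G x -> (x * e)%g = x.
Hypothesis Ginv : forall x, G x -> G (inv x).
Hypothesis invK : involutive inv.
Hypothesis Gvl : forall x, G x -> (inv x * x)%g = e.
Implicit Types (f g h k : l1 R T).

Let Gvr r : G r -> (r * inv r)%g = e.
Proof. by move=> Gr; rewrite -{1}(invK r) Gvl//; exact: Ginv. Qed.

Definition l1_on f := forall t, f t != 0 -> G t.

Lemma normc_conj (z : R[i]) : normc z^* = normc z.
Proof. by case: z => a b /=; rewrite sqrrN. Qed.

Lemma star_summable f : (fun t => (f (inv t))^* : R[i]^o) \in @l1_pred R T.
Proof.
apply/l1P; rewrite (eq_esum (b := fun t => (normc (f (inv t)))%:E)); last first.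
  by move=> t _; rewrite normc_conj.
rewrite -(reindex_esum setT setT inv (fun t => (normc (f t))%:E)).
  exact: l1_abs_summable.
by split=> // [x y _ _ /(can_inj invK)//|x _]; exists (inv x).
Qed.

(** The adjoint. Since [inv] is an involution of all of [T], it is defined on the whole of l^1; it
    is adjoint for the inner product on elements supported on the group [G]. *)
Definition l1_star f : l1 R T := L1 (star_summable f).

Lemma pairing_star f (chi : T -> R[i]) :
  pairing (l1_star f) chi = (pairing f (fun t => (chi (inv t))^*))^*.
Proof.
have inv_bij : set_bij setT setT inv.
  by split=> // [x y _ _ /(can_inj invK)//|x _]; exists (inv x).
rewrite /pairing -csum_conj (csum_reindex _ inv_bij).
by apply: eq_csum => t _; rewrite conjcM conjcK /= invK.
Qed.

Lemma bounded_conj (X : Type) (chi : X -> R[i]) :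
  bounded_fun chi -> bounded_fun (fun x => (chi x)^*).
Proof. by move=> [C chiC]; exists C => x; rewrite normc_conj. Qed.

Lemma bounded_l1_conj f : bounded_fun (fun t => (f t)^*).
Proof. exact/bounded_conj/bounded_l1. Qed.

Lemma l1_on0 : l1_on 0. Proof. by move=> t; rewrite l1_zero eqxx. Qed.

Lemma l1_onDZ (a : R[i]) f g : l1_on f -> l1_on g -> l1_on (a *: f + g).
Proof.
move=> fG gG t; have [//|nGt] := pselect (G t).
have z0 h : l1_on h -> h t = 0 by move=> hG; apply: contrapT => /eqP/hG.
by rewrite l1_add l1_scale !z0// mulr0 addr0 eqxx.
Qed.

Lemma l1_onZ (a : R[i]) f : l1_on f -> l1_on (a *: f).
Proof. by move=> fG; rewrite -[_ *: _]addr0; apply: l1_onDZ l1_on0. Qed.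

Lemma l1_onD f g : l1_on f -> l1_on g -> l1_on (f + g).
Proof. by move=> fG gG; rewrite -[f]scale1r; apply: l1_onDZ. Qed.

Lemma l1_on_delta t : G t -> l1_on (l1_delta R t).
Proof. by move=> Gt s; have [->//|/negPf st] := eqVneq s t; rewrite /= st eqxx. Qed.

Lemma l1_on_star f : l1_on f -> l1_on (l1_star f).
Proof.
move=> fG t /=; rewrite fmorph_eq0 => /fG/Ginv; by rewrite invK.
Qed.

Lemma pairing0 (X : choiceType) (f : l1 R X) (chi : X -> R[i]) :
  (forall t, f t != 0 -> chi t = 0) -> pairing f chi = 0.
Proof.
move=> chi0; rewrite (eq_pairing (psi := fun=> 0))//.
apply: etrans (mul0r (csum setT f)); rewrite -csumZ; last exact: l1_abs_summable.
by apply: eq_csum => t _; rewrite mulr0 mul0r.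
Qed.

Lemma conv_at f g t :
  (f \star g) t = pairing f (fun r => pairing g (fun s => if (r * s)%g == t then 1 else 0)).
Proof. by rewrite -pairing_indic pairing_conv//; exact: bounded_indic. Qed.

Lemma l1_on_conv f g : l1_on f -> l1_on g -> l1_on (f \star g).
Proof.
move=> fG gG t; have [//|nGt] := pselect (G t).
rewrite conv_at pairing0 ?eqxx// => r /fG Gr; apply: pairing0 => s /gG Gs.
by case: eqP => // rst; case: nGt; rewrite -rst; exact: GM.
Qed.

Lemma conv_unitl f : l1_on f -> l1_delta R e \star f = f.
Proof.
move=> fG; apply: pairing_ext => chi chiB; rewrite pairing_conv// pairing_delta.
by apply: eq_pairing => t /fG/Gel ->.
Qed.

(** In the group, the substitution [v = r * s], that is [s = inv r * v], moves [k] to the other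
    side. *)
Lemma pairing_adjoint k (x y : l1 R T) : l1_on k -> l1_on x -> l1_on y ->
  pairing (k \star x) (fun t => (y t)^*) =
  pairing x (fun t => ((l1_star k \star y) t)^*).
Proof.
move=> kG xG yG; have [C yC] := bounded_l1_conj y.
rewrite pairing_conv; last by exists C.
rewrite pairing_swap; last by exists C => ?; exact: yC.
apply: eq_pairing => s /xG Gs; rewrite conv_at.
have -> : pairing (l1_star k)
    (fun r => pairing y (fun v => if (r * v)%g == s then 1 else 0)) =
    pairing (l1_star k) (fun r => y (inv r * s)%g).
  apply: eq_pairing => r /(l1_on_star kG) Gr.
  rewrite -[RHS]pairing_indic; apply: eq_pairing => v /yG Gv.
  congr (if _ then _ else _); apply/eqP/eqP => [<-|->].
    by rewrite mulgA Gvl// Gel.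
  by rewrite mulgA Gvr// Gel.
rewrite pairing_star conjcK; apply: eq_pairing => r _.
by rewrite invK.
Qed.

(** The real part of the l^2 inner product: a real symmetric bilinear form, for which real scalars
    suffice. *)
Definition l1_inner f g : R := Re (pairing f (fun t => (g t)^*)).

Lemma l1_innerC f g : l1_inner f g = l1_inner g f.
Proof.
rewrite /l1_inner /pairing.
rewrite (eq_csum (G := fun t => (g t * (f t)^*)^*)).
  by rewrite csum_conj; case: (csum _ _).
by move=> t _; rewrite conjcM conjcK mulrC.
Qed.

Lemma l1_innerDZl (c : R) f g h :
  l1_inner (c%:C *: f + g) h = c * l1_inner f h + l1_inner g h.
Proof.
rewrite /l1_inner pairingDZl; last exact: bounded_l1_conj.
by case: (pairing f _) (pairing g _) => [? ?] [? ?] /=; rewrite mul0r subr0.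
Qed.

Lemma l1_innerDZr (c : R) f g h :
  l1_inner h (c%:C *: f + g) = c * l1_inner h f + l1_inner h g.
Proof. by rewrite ![l1_inner h _]l1_innerC l1_innerDZl. Qed.

(** [l1_inner f f] is the sum of the squared moduli of the values of [f], and one term is singled
    out. Positivity of the form follows from this bound. *)
Lemma l1_inner_ge f t : normc (f t) ^+ 2 <= l1_inner f f.
Proof.
have [C fC] := bounded_l1_conj f.
have fs := pairing_abs_summable f (ex_intro _ C fC : bounded_fun _).
pose u s : R := normc (f s) ^+ 2.
have uE s : Re (f s * (f s)^*) = u s.
  rewrite /u; case: (f s) => a b /=; rewrite sqr_sqrtr ?addr_ge0 ?sqr_ge0//.
  by rewrite mulrN opprK !expr2.
have u0 s : 0 <= u s by exact: sqr_ge0.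
have us : (\esum_(s in setT) (u s)%:E < +oo)%E.
  apply: abs_summableW fs => s _; rewrite u0 -uE /=.
  exact: le_trans (ler_norm _) (Re_le_normc _).
have -> : l1_inner f f = fine (\esum_(s in setT) (u s)%:E).
  rewrite /l1_inner /pairing /csum /=.
  rewrite (@rsum_diff _ _ _ _ u (fun=> 0))//.
  - by rewrite [X in _ - fine X]esum1 ?subr0.
  - by rewrite esum1.
  - by move=> s _; rewrite uE subr0.
rewrite -lee_fin fineK; last first.
  by rewrite ge0_fin_numE// esum_ge0// => s _; rewrite lee_fin.
rewrite (esumID [set t])//; last by move=> s _; rewrite lee_fin.
rewrite setTI esum_set1 ?lee_fin// leeDl// esum_ge0// => s _; by rewrite lee_fin.
Qed.

Lemma l1_inner_ge0 f : 0 <= l1_inner f f.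
Proof. by apply: le_trans (l1_inner_ge f e); exact: sqr_ge0. Qed.

Lemma l1_inner_gt0 f : f != 0 -> 0 < l1_inner f f.
Proof.
move=> f0; have [t ft] : exists t, f t != 0.
  apply: contrapT => /forallNP f0'; move/eqP: f0; apply; apply: l1_ext => t.
  by apply/eqP/negPn/negP; exact: f0'.
apply: lt_le_trans (l1_inner_ge f t); rewrite exprn_gt0// lt_neqAle normc_ge0 andbT.
by apply: contra_neq ft => /esym/Normc.eq0_normc.
Qed.

Lemma l1_inner_adjoint k (x y : l1 R T) : l1_on k -> l1_on x -> l1_on y ->
  l1_inner (k \star x) y = l1_inner x (l1_star k \star y).
Proof. by move=> kG xG yG; rewrite /l1_inner pairing_adjoint. Qed.

Lemma l1_inner_sqr (c : R) f g : l1_inner (c%:C *: f + g) (c%:C *: f + g) =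
  c ^+ 2 * l1_inner f f + 2 * c * l1_inner f g + l1_inner g g.
Proof. by rewrite l1_innerDZl !l1_innerDZr (l1_innerC g f); ring. Qed.

Lemma l1_inner_cauchy_schwarz f g :
  l1_inner f g ^+ 2 <= l1_inner f f * l1_inner g g.
Proof.
have [f0|f0] := eqVneq f 0.
  have H0 h : l1_inner 0 h = 0.
    by rewrite /l1_inner pairing0// => t; rewrite l1_zero eqxx.
  by rewrite f0 !H0 mul0r expr0n.
have := l1_inner_gt0 f0; set p := l1_inner f f; set q := l1_inner f g => p0.
have := l1_inner_ge0 ((- q / p)%:C *: f + g); rewrite l1_inner_sqr -/p -/q.
set r := l1_inner g g => H.
have : 0 <= p * ((- q / p) ^+ 2 * p + 2 * (- q / p) * q + r) by rewrite pmulr_rge0.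
have -> : p * ((- q / p) ^+ 2 * p + 2 * (- q / p) * q + r) = p * r - q ^+ 2.
  by field; rewrite gt_eqF.
by rewrite subr_ge0.
Qed.

Lemma l1_inner_abs_le f g : `|l1_inner f g| *+ 2 <= l1_inner f f + l1_inner g g.
Proof.
have := l1_inner_ge0 (1%:C *: f + g); have := l1_inner_ge0 ((-1)%:C *: f + g).
rewrite !l1_inner_sqr mulr2n => h1 h2.
by case: (ger0P (l1_inner f g)) => h; lra.
Qed.

Definition conv_pow h n : l1 R T := iter n (conv h) (l1_delta R e).

Lemma conv_powS h n : conv_pow h n.+1 = h \star conv_pow h n.
Proof. by []. Qed.

Lemma l1_on_pow h n : l1_on h -> l1_on (conv_pow h n).
Proof.
by move=> hG; elim: n => [|n IH]; [exact: l1_on_delta|exact: l1_on_conv].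
Qed.

Lemma l1_star_delta r : l1_star (l1_delta R r) = l1_delta R (inv r).
Proof.
apply: l1_ext => t /=; rewrite (inv_eq invK).
by case: eqP => _; rewrite ?rmorph1 ?rmorph0.
Qed.

Lemma pairing_le_on f (chi : T -> R[i]) (C : R) : 0 <= C -> l1_on f ->
  (forall t, G t -> normc (chi t) <= C) ->
  normc (pairing f chi) <= (C * l1_norm f) *+ 2.
Proof.
move=> C0 fG chiC.
rewrite (eq_pairing (psi := fun t => if f t == 0 then 0 else chi t)); last first.
  by move=> t /negPf ->.
apply: pairing_le => // t; case: ifPn => [_|/fG/chiC//].
by rewrite Normc.normc0.
Qed.

(** Translation by an element of [G] preserves the l^2 norm, so each translate of [f] has inner
    product with [f] of modulus at most twice the square norm; these are summed against [u]. *)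
Lemma l1_inner_conv_le u f : l1_on u -> l1_on f ->
  l1_inner (u \star f) f <= (l1_inner f f *+ 2 * l1_norm u) *+ 2.
Proof.
move=> uG fG; have [C fC] := bounded_l1_conj f.
apply: (le_trans (le_trans (ler_norm _) (Re_le_normc _))).
rewrite pairing_conv; last by exists C.
apply: pairing_le_on => // [|r Gr]; first by rewrite mulrn_wge0// l1_inner_ge0.
pose g := l1_delta R r \star f.
have gG : l1_on g by apply: l1_on_conv => //; exact: l1_on_delta.
have -> : pairing f (fun s => (f (r * s)%g)^*) = pairing g (fun t => (f t)^*).
  by rewrite pairing_conv ?pairing_delta//; exists C.
have gg : l1_inner g g = l1_inner f f.
  rewrite l1_inner_adjoint//; last exact: l1_on_delta.
  by rewrite l1_star_delta convA l1_deltaM Gvl// conv_unitl.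
(* Multiplication by [c], which is minus the imaginary unit, turns imaginary parts into real ones,
   so that [l1_inner_abs_le] controls both. *)
pose c : R[i] := 0 -i* 1.
have cE h h' : l1_inner (c *: h) h' = Im (pairing h (fun t => (h' t)^*)).
  have := pairingDZl c h 0 (bounded_l1_conj h'); rewrite /l1_inner addr0 => ->.
  have -> : pairing 0 (fun t => (h' t)^*) = 0.
    by apply: pairing0 => t; rewrite l1_zero eqxx.
  by rewrite addr0; case: (pairing _ _) => a b /=; rewrite mul0r add0r mulN1r opprK.
have cc : l1_inner (c *: g) (c *: g) = l1_inner g g.
  rewrite cE; have -> : (fun t => ((c *: g) t)^*) = fun t => conjc c * (g t)^* + 0.
    by apply/funext => t; rewrite l1_scale conjcM addr0.
  have b0 : bounded_fun (fun _ : T => 0 : R[i]).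
    by exists 0 => t; rewrite Normc.normc0.
  rewrite pairingDZr//; last exact: bounded_l1_conj.
  rewrite [pairing g (fun=> 0)]pairing0// addr0 /l1_inner.
  by case: (pairing _ _) => a b /=; rewrite mul0r add0r opprK mul1r.
have h1 := l1_inner_abs_le g f; have h2 := l1_inner_abs_le (c *: g) f.
apply: le_trans (normc_ReIm _) _; rewrite -cE -/(l1_inner g f).
move: h1 h2; rewrite cc gg !mulr2n; lra.
Qed.

(** * Positive elements and their moments *)

Section PositiveElement.
Variables (k : l1 R T).
Hypothesis kG : l1_on k.
Let h := l1_star k \star k.
Let p n := conv_pow h n.

Lemma l1_on_pos : l1_on h.
Proof. by apply: l1_on_conv => //; exact: l1_on_star. Qed.

Let pG n : l1_on (p n). Proof. exact/l1_on_pow/l1_on_pos. Qed.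

Lemma l1_inner_pos (x y : l1 R T) : l1_on x -> l1_on y ->
  l1_inner (h \star x) y = l1_inner (k \star x) (k \star y).
Proof.
move=> xG yG; rewrite l1_innerC /h -convA -l1_inner_adjoint//; first exact: l1_innerC.
exact: l1_on_conv.
Qed.

Lemma l1_inner_pos_sym (x y : l1 R T) : l1_on x -> l1_on y ->
  l1_inner (h \star x) y = l1_inner x (h \star y).
Proof.
by move=> xG yG; rewrite l1_inner_pos// [RHS]l1_innerC l1_inner_pos// l1_innerC.
Qed.

(** The real part of the coefficient of [h^n] at [e]: a moment of the spectral measure of [h] at the
    point mass at [e]. *)
Definition moment n := l1_inner (p n) (l1_delta R e).

Lemma l1_inner_moment m n : l1_inner (p m) (p n) = moment (m + n).
Proof.
elim: n m => [|n IH] m; first by rewrite addn0.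
by rewrite -[p n.+1]/(h \star p n) -l1_inner_pos_sym// -[h \star p m]/(p m.+1) IH addSnnS.
Qed.

Lemma l1_inner_momentS m n :
  l1_inner (k \star p m) (k \star p n) = moment (m + n).+1.
Proof. by rewrite -l1_inner_pos// -[h \star p m]/(p m.+1) l1_inner_moment. Qed.

Lemma moment0 : moment 0 = 1.
Proof.
by rewrite /moment /l1_inner pairing_delta l1_deltaE eqxx.
Qed.

Lemma moment1 : moment 1 = l1_inner k k.
Proof.
have := l1_inner_momentS 0 0; rewrite /= => <-.
suff -> : k \star p 0 = k by [].
apply: pairing_ext => chi chiB; rewrite pairing_conv//; apply: eq_pairing => r kr.
by rewrite pairing_delta Ger//; exact: kG.
Qed.

Lemma moment_ge0 n : 0 <= moment n.
Proof.
have := odd_double_half n; case: (odd n) => <-; rewrite -addnn.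
  by rewrite -[(true + _)%N]/(_.+1) -l1_inner_momentS l1_inner_ge0.
by rewrite add0n -l1_inner_moment l1_inner_ge0.
Qed.

(** Cauchy-Schwarz, for [h^m] and [h^(m+1)] when [n = 2m], and for [k h^m] and [k h^(m+1)] when
    [n = 2m+1]. *)
Lemma moment_log_convex n : moment n.+1 ^+ 2 <= moment n * moment n.+2.
Proof.
have := odd_double_half n; case: (odd n) => <-; rewrite -addnn; set m := n./2.
  have := l1_inner_cauchy_schwarz (k \star p m) (k \star p m.+1).
  by rewrite !l1_inner_momentS !addnS !addSn.
have := l1_inner_cauchy_schwarz (p m) (p m.+1).
by rewrite !l1_inner_moment !addnS !addSn.
Qed.

Lemma moment_geometric : k != 0 -> forall n, 0 < moment n /\
  l1_inner k k * moment n <= moment n.+1.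
Proof.
move=> k0; rewrite -moment1; apply: geometric_of_log_convex.
- exact: moment0.
- by rewrite moment1 l1_inner_gt0.
- exact: moment_ge0.
- exact: moment_log_convex.
Qed.

(* If [M] is the supremum of the ratios of consecutive moments, the vectors
   [h^n] are approximate eigenvectors of [h] at [M], so [1 - h / M] cannot have
   a left inverse. *)
Lemma pos_quasi_invertible_eq0 :
  (forall c : R, exists2 g, l1_on g & g = c%:C *: h + c%:C *: (g \star h)) -> k = 0.
Proof.
move=> quasi; apply: contrapT => /eqP k0.
have m0 n := proj1 (moment_geometric k0 n).
have [||M M0 [Mub Msup]] := log_convex_sup_ratio (C := l1_norm h *+ 4) m0.
- exact: moment_log_convex.
- move=> n; have := l1_inner_conv_le l1_on_pos (@pG n).
  rewrite -[h \star p n]/(p n.+1) !l1_inner_moment addSn addnn.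
  by rewrite !mulrnAl -!mulrnA mulrC.
(* [r] is a left inverse of [1 - c h]. It recovers [h^n] from [y n], which is [(1 - c h) h^n], so
   [y n] cannot be short compared with [h^n]. *)
have [g gG gE] := quasi M^-1; pose c := M^-1; pose r := l1_delta R e + g.
have rG : l1_on r by apply: l1_onD => //; exact: l1_on_delta.
have hG := l1_on_pos; have rsG := l1_on_star rG.
pose y n := (- c)%:C *: p n.+1 + p n.
have yG n : l1_on (y n) by apply: l1_onDZ.
have rE (z : l1 R T) : l1_on z -> r \star z = z + g \star z.
  by move=> zG; rewrite convDl conv_unitl.
have cN : (- c)%:C = - c%:C :> R[i] by apply/eqP; rewrite eq_complex /= oppr0 !eqxx.
have gp n : g \star p n = c%:C *: p n.+1 + c%:C *: (g \star p n.+1).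
  by rewrite {1}gE convDl !convZl -convA.
have ry n : r \star y n = p n.
  by rewrite convDZr !rE// (gp n) cN scaleNr -scalerDr addrCA addNr addr0.
pose D := (1 *+ 2 * l1_norm (l1_star r \star r)) *+ 2.
have D0 : 0 <= D by rewrite mulrn_wge0// mulr_ge0// l1_norm_ge0.
have yD n : moment n.*2 <= D * l1_inner (y n) (y n).
  rewrite -addnn -l1_inner_moment -{1 2}(ry n) l1_inner_adjoint//; last first.
    exact: l1_on_conv.
  rewrite convA l1_innerC; apply: le_trans (l1_inner_conv_le _ _) _ => //.
    exact: l1_on_conv.
  by rewrite /D !mulrnAl mul1r mulrC.
have yy n : l1_inner (y n) (y n) =
    c ^+ 2 * moment n.*2.+2 - 2 * c * moment n.*2.+1 + moment n.*2.
  by rewrite l1_inner_sqr !l1_inner_moment sqrrN !addSn !addnS !addnn; ring.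
have cM : c * M = 1 by rewrite mulVf// gt_eqF.
have c0 : 0 < c by rewrite invr_gt0.
have yle n : moment n.*2 <= D * (moment n.*2 - c * moment n.*2.+1).
  apply: le_trans (yD n) _; rewrite yy ler_wpM2l//.
  have : c ^+ 2 * moment n.*2.+2 <= c ^+ 2 * (M * moment n.*2.+1).
    by rewrite ler_wpM2l// sqr_ge0.
  have -> : c ^+ 2 * (M * moment n.*2.+1) = (c * M) * (c * moment n.*2.+1) by ring.
  by rewrite cM; lra.
(* At this index [1 - c b / a] is below [1 / (D + 1)], where [a] and [b] are the moments at [n.*2]
   and [n.*2.+1]; then [yle] gives [a <= a D / (D + 1)], which is absurd. *)
have [n nP] := Msup (M * (1 - (D + 1)^-1)) (ltac:(
  rewrite gtr_pMr// ltrBlDr ltrDl invr_gt0; lra)).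
have := yle n; have := m0 n.*2; move: nP.
rewrite -(ltr_pM2l c0) !mulrA cM mul1r.
set a := moment _; set b := moment _; set d := (D + 1)^-1 => ab a0 aD.
have dE : d * (D + 1) = 1 by rewrite mulVf// gt_eqF//; lra.
have : D * (a - c * b) <= D * (d * a) by apply: ler_wpM2l => //; lra.
have -> : D * (d * a) = a - d * a.
  by rewrite mulrA [D * d]mulrC -[in LHS](addrK 1 D) mulrBr dE mulr1 mulrBl mul1r.
have : 0 < d * a by rewrite mulr_gt0// invr_gt0; lra.
lra.
Qed.

(** Normality makes [h] commute with [k], so the outermost factors [k] on the two sides are traded,
    one pair at a time, for a factor [h] on the left. *)
Lemma l1_inner_normal_pow n (x y : l1 R T) : l1_star k \star k = k \star l1_star k ->
  l1_on x -> l1_on y ->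
  l1_inner (iter n (conv k) x) (iter n (conv k) y) = l1_inner (iter n (conv h) x) y.
Proof.
move=> kN xG yG; have hk z : h \star (k \star z) = k \star (h \star z).
  by rewrite /h !convA {1}kN.
have onk m z : l1_on z -> l1_on (iter m (conv k) z).
  by move=> zG; elim: m => // m IH; exact: l1_on_conv.
elim: n x xG => // n IH x xG.
rewrite !iterS -l1_inner_pos; [|exact: onk|exact: onk].
have -> : h \star iter n (conv k) x = iter n (conv k) (h \star x).
  by elim: n {IH} => // n IHn; rewrite !iterS hk IHn.
by rewrite IH -?iterSr//; apply: l1_on_conv => //; exact: l1_on_pos.
Qed.

(** For a normal [k] the square l^2 norm of [k^n] is the [n]-th moment of [h], and the moments grow
    at least geometrically. *)
Lemma normal_pow_growth n : l1_star k \star k = k \star l1_star k -> k != 0 ->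
  l1_inner k k ^+ n <= l1_inner (conv_pow k n) (conv_pow k n).
Proof.
move=> kN k0; rewrite l1_inner_normal_pow//; [|exact: l1_on_delta|exact: l1_on_delta].
rewrite -/(p n) -/(moment n); elim: n => [|n IH]; first by rewrite moment0.
have [_] := moment_geometric k0 n; apply: le_trans.
by rewrite exprS ler_wpM2l// l1_inner_ge0.
Qed.

End PositiveElement.
End GroupAlgebra.

(** * Ultrafilters *)

Lemma bigcap_chain_closed_nonempty (X : topologicalType) (C : set (set X)) :
  compact [set: X] -> C !=set0 -> (forall M, C M -> closed M /\ M !=set0) ->
  total_on C subset -> \bigcap_(M in C) M !=set0.
Proof.
move=> cX C0 Ccl Ctot; pose F := filter_from C id.
have FF : ProperFilter F.
  apply: filter_from_proper; last by move=> M /Ccl[].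
  apply: filter_from_filter => // M N CM CN.
  have [MN|NM] := Ctot _ _ CM CN; first by exists M => // x Mx; split=> //; exact: MN.
  by exists N => // x Nx; split=> //; exact: NM.
have [p [_ pF]] := cX F FF filterT.
exists p => M CM; have [+ _] := Ccl _ CM; apply => B /(pF M B) H.
by apply: H; exists M.
Qed.

(** * Minimal closed left ideals and idempotents in [beta S] *)

Section Idempotents.
Variable S : semigroupType.
Implicit Types (D L M : set (beta S)).

Lemma beta_closed_compact M : closed M -> compact M.
Proof. by move=> cM; apply: (subclosed_compact cM (@beta_compact S)). Qed.

Lemma closed_mulr_image M (q : beta S) : closed M ->
  closed [set (p * q)%g | p in M].
Proof.
move=> cM; apply: compact_closed; first exact: beta_hausdorff.
apply: continuous_compact; last exact: beta_closed_compact.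
exact/continuous_subspaceT/beta_mulr_continuous.
Qed.

(* With [D] empty these are the closed subsemigroups, with [D] a semigroup
   containing [M] the closed left ideals of [D]. *)
Definition closed_stable D M :=
  [/\ closed M, M !=set0 & forall x y, D x \/ M x -> M y -> M (x * y)%g].

Lemma minimal_closed_stable D L : closed_stable D L ->
  exists M, [/\ closed_stable D M, M `<=` L &
    forall N, closed_stable D N -> N `<=` M -> N = M].
Proof.
move=> Ls; pose P := [set U | closed_stable D (L `\` U)].
have [F FP Ftot|U [PU Umax]] := @Zorn_bigcup _ P.
  have [F0|/set0P F0] := eqVneq F set0; first by rewrite /P /= F0 bigcup_set0 setD0.
  have -> : P (\bigcup_(X in F) X) = closed_stable D (\bigcap_(M in [set L `\` X | X in F]) M).
    congr closed_stable; apply/seteqP; split=> [x [Lx nx] _ [X FX <-]|x xP].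
      by split=> // Xx; apply: nx; exists X.
    have [X0 FX0] := F0.
    split=> [|[X FX Xx]]; first by have [] := xP _ (ex_intro2 _ _ _ FX0 erefl).
    by have [] := xP _ (ex_intro2 _ _ _ FX erefl).
  split.
  - by apply: closed_bigI => _ [X FX <-]; have [] := FP _ FX.
  - apply: bigcap_chain_closed_nonempty.
    + exact: beta_compact.
    + by have [X FX] := F0; exists (L `\` X), X.
    + by move=> _ [X FX <-]; have [] := FP _ FX.
    + move=> _ _ [X FX <-] [Y FY <-]; have [XY|YX] := Ftot _ _ FX FY; [right|left];
      by move=> x [Lx nx]; split=> // xx; apply: nx; auto.
  - move=> x y Dx yM _ [X FX <-]; have [_ _ st] := FP _ FX.
    apply: st; last by apply: yM; exists X.
    by case: Dx => [|xM]; [left|right; apply: xM; exists X].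
exists (L `\` U); split=> //.
move=> N Ns NM; apply: contrapT => NMn.
apply: (Umax (~` N)); last first.
  by rewrite /P /= setDE setCK setIidr// => x /NM[].
split=> [x Ux /NM[]//|NU].
apply: NMn; apply/seteqP; split=> // x [Lx nUx]; apply: contrapT => nNx.
by apply: nUx; exact: NU.
Qed.

Lemma closed_semigroup_idempotent M :
  closed M -> M !=set0 -> (forall x y, M x -> M y -> M (x * y)%g) ->
  exists2 e, M e & (e * e)%g = e.
Proof.
move=> Mc M0 MM.
have [|N [[Nc [x Nx] NNN] NM Nmin]] := @minimal_closed_stable set0 M.
  by split=> // x y [//|]; exact: MM.
have NN y z : N y -> N z -> N (y * z)%g by move=> Ny; apply: NNN; right.
have Nx_eq : [set (y * x)%g | y in N] = N.
  apply: Nmin; last by move=> _ [y Ny <-]; exact: NN.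
  split; [exact: closed_mulr_image|by exists (x * x)%g, x|].
  move=> _ _ [//|[y Ny <-]] [z Nz <-]; exists (y * x * z)%g; last by rewrite !mulgA.
  by apply: (NN) => //; exact: NN.
have fix_eq : N `&` [set y | (y * x)%g = x] = N.
  apply: Nmin; last by move=> y [].
  split.
  - apply: closedI => //.
    have -> : [set y | (y * x)%g = x] = (fun y : beta S => (y * x)%g) @^-1` [set x] by [].
    apply: preimage_closed; first by move=> y _; exact: beta_mulr_continuous.
    exact: (compact_closed (@beta_hausdorff S) (@compact_set1 _ x)).
  - by have : N x by []; rewrite -{1}Nx_eq => -[y Ny yx]; exists y.
  - move=> y z [//|[Ny yx]] [Nz zx]; split; first exact: NN.
    by rewrite /= -mulgA zx.
exists x; first exact: NM.
by move: Nx; rewrite -fix_eq => -[].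
Qed.

Lemma minimal_left_idempotent D : closed D -> D !=set0 ->
  (forall x y, D x -> D y -> D (x * y)%g) ->
  exists e, [/\ D e, (e * e)%g = e &
    forall x, D x -> exists2 y, D y & (y * x * e)%g = e].
Proof.
move=> Dc D0 DD.
have [|L [[Lc L0 DL] LD Lmin]] := @minimal_closed_stable D D.
  by split=> // x y [|]; exact: DD.
have [|e Le ee] := closed_semigroup_idempotent Lc L0.
  by move=> x y Lx; apply: DL; left; exact: LD.
exists e; split=> [||x Dx] //; first exact: LD.
have LE : [set (y * (x * e))%g | y in D] = L.
  have Lxe : L (x * e)%g by apply: DL => //; left.
  apply: Lmin; last by move=> _ [y Dy <-]; apply: DL => //; left.
  split; [exact: closed_mulr_image|by exists (x * (x * e))%g, x|].
  move=> y _ Dy [z Dz <-]; exists (y * z)%g; last by rewrite !mulgA.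
  apply: (DD) => //; case: Dy => // -[w Dw <-].
  by apply: (DD) => //; exact: LD.
by move: Le; rewrite -{1}LE => -[y Dy ye]; exists y => //; rewrite -mulgA.
Qed.

End Idempotents.

Section Ultrafilters.
Variable S : Type.
Implicit Types (p q : beta S) (A B : set S).

Lemma beta_initial_segment (I : Type) (nu : I -> nat) p (P : I -> set S) n :
  injective nu ->
  (forall i, p (P i)) -> p [set s | forall i, (nu i < n)%N -> P i s].
Proof.
move=> nu_inj FP; elim: n => [|n IH]; first by apply: betaS (betaT p) => s _ i.
have [[i0 i0n]|noi] := pselect (exists i, nu i = n).
  apply: betaS (iffRL (betaI p _ _) (conj IH (FP i0))) => s [sP si0] i; rewrite ltnS leq_eqVlt.
  by case/orP=> [/eqP ni|/sP//]; have -> : i = i0 by apply: nu_inj; rewrite ni.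
apply: betaS IH => s sP i; rewrite ltnS leq_eqVlt => /orP[/eqP ni|/sP//].
by case: noi; exists i.
Qed.

Lemma closure_ultrafilter (I : Type) (x : beta S) (y : I -> beta S) (E : set I) :
  (forall A, x A -> exists2 c, E c & y c A) ->
  exists2 w : beta I, w E & forall A, x A -> w [set c | y c A].
Proof.
move=> xy; pose F := filter_from (beta_filter x) (fun A => [set c | E c /\ y c A]).
have FF : ProperFilter F.
  apply: filter_from_proper; last by move=> A /xy[c Ec yA]; exists c.
  apply: filter_from_filter; first by exists setT; exact: betaT.
  move=> A B xA xB; exists (A `&` B); first by apply/betaI.
  by move=> c [Ec /betaI[yA yB]].
have [W [WU FW]] := ultraFilterLemma FF.
exists (Beta WU) => [|A xA] /=; apply: FW.
  by exists setT => [|c []]//; exact: betaT.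
by exists A => // c [].
Qed.

End Ultrafilters.

(* Otherwise choose sets separating each [x a] from all [y c] and conversely, and
   make them disjoint by interleaving them along [nu] and [mu]. *)
Lemma ultrafilter_separation (S I J : Type) (nu : I -> nat) (mu : J -> nat)
    (t : beta I) (w : beta J) (x : I -> beta S) (y : J -> beta S) (D : set I) (E : set J) :
  injective nu -> injective mu -> t D -> w E ->
  (forall A, t [set a | x a A] -> w [set c | y c A]) ->
  (exists2 a, D a & exists2 w' : beta J, w' E & forall A, x a A -> w' [set c | y c A]) \/
  (exists2 c, E c & exists2 t' : beta I, t' D & forall A, y c A -> t' [set a | x a A]).
Proof.
move=> nu_inj mu_inj tD wE tw; apply: contrapT => /not_orP[nx ny].
have {nx} xU a : exists U : set S, D a -> x a U /\ forall c, E c -> ~ y c U.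
  have [Da|nDa] := pselect (D a); last by exists setT.
  apply: contrapT => /forallNP nU; apply: nx; exists a => //.
  apply: closure_ultrafilter => A xA; apply: contrapT => yA.
  apply: (nU A) => _; split=> // c Ec yc; apply: yA; by exists c.
have {ny} yV c : exists V : set S, E c -> y c V /\ forall a, D a -> ~ x a V.
  have [Ec|nEc] := pselect (E c); last by exists setT.
  apply: contrapT => /forallNP nU; apply: ny; exists c => //.
  apply: closure_ultrafilter => A yA; apply: contrapT => xA.
  apply: (nU A) => _; split=> // a Da xa; apply: xA; by exists a.
have [U UP] := choice xU; have [V VP] := choice yV.
pose A := [set s | exists a, [/\ D a, U a s &
  forall c, (mu c < (nu a).+1)%N -> E c -> ~ V c s]].
pose B := [set s | exists c, [/\ E c, V c s &
  forall a, (nu a < (mu c).+1)%N -> D a -> ~ U a s]].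
have xA a : D a -> x a A.
  move=> Da; have [xUa _] := UP a Da.
  have H c : x a [set s | E c -> ~ V c s].
    have [Ec|nEc] := pselect (E c); last by apply: betaS (betaT (x a)) => s _ /nEc.
    by apply: betaS (iffRL (betaC (x a) (V c)) (proj2 (VP c Ec) a Da)) => s nV _.
  have := beta_initial_segment (nu a).+1 mu_inj H.
  move=> xP; apply: betaS (iffRL (betaI (x a) _ _) (conj xUa xP)) => s [Us sP].
  by exists a.
have yB c : E c -> y c B.
  move=> Ec; have [yVc _] := VP c Ec.
  have H a : y c [set s | D a -> ~ U a s].
    have [Da|nDa] := pselect (D a); last by apply: betaS (betaT (y c)) => s _ /nDa.
    by apply: betaS (iffRL (betaC (y c) (U a)) (proj2 (UP a Da) c Ec)) => s nU _.
  have := beta_initial_segment (mu c).+1 nu_inj H.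
  move=> yP; apply: betaS (iffRL (betaI (y c) _ _) (conj yVc yP)) => s [Us sP].
  by exists c.
have wA : w [set c | y c A] by apply: tw; apply: betaS tD => a; exact: xA.
have wB : w [set c | y c B] by apply: betaS wE => c; exact: yB.
have [c [ycA ycB]] := @filter_ex _ w _ _ (iffRL (betaI w _ _) (conj wA wB)).
have /(@filter_ex _ (y c))[s [[a [Da Us aP]] [c' [Ec' Vs cP]]]] :
  y c (A `&` B) by apply/betaI.
have [le|lt] := leqP (mu c') (nu a); first by apply: (aP c') => //; rewrite ltnS.
by apply: (cP a) => //; rewrite ltnS ltnW.
Qed.

Section BetaTranslations.
Variable S : cancelSemigroupType.
Implicit Types (p q t w : beta S) (a b c : S).

Lemma principal_mulE a (z : beta S) A :
  (principal a * z)%g A <-> z [set v | A (a * v)%g].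
Proof. by rewrite beta_mulE principalE. Qed.

Lemma beta_mul_liml t (z : beta S) A :
  (t * z)%g A <-> t [set a | (principal a * z)%g A].
Proof. by rewrite beta_mulE; split; apply: betaS => a /principal_mulE. Qed.

Lemma beta_mul_limm a q (s : beta S) A :
  (principal a * (q * s))%g A <-> q [set b | (principal (a * b)%g * s)%g A].
Proof.
rewrite principal_mulE beta_mulE; split; apply: betaS => b /=.
  by move=> H; apply/principal_mulE; apply: betaS H => v /=; rewrite mulgA.
by move=> /principal_mulE; apply: betaS => v /=; rewrite mulgA.
Qed.

Lemma principal_mul_inj a : injective (fun z : beta S => (principal a * z)%g).
Proof.
move=> x y xy; apply: betaP => A xA.
have : (principal a * y)%g [set (a * t)%g | t in A].
  by rewrite -xy; apply/principal_mulE; apply: betaS xA => t At; exists t.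
by move=> /principal_mulE; apply: betaS => t [u Au] /mulg_injl <-.
Qed.

Lemma principal_mulC : (forall s t : S, (s * t = t * s)%g) ->
  forall a (z : beta S), (principal a * z = z * principal a)%g.
Proof.
move=> SC a z; apply: betaP => A /principal_mulE zA; apply/beta_mulE.
by apply: betaS zA => s As; apply/principalE; rewrite /= SC.
Qed.

Section Countable.
Variable nu : S -> nat.
Hypothesis nu_inj : injective nu.

(* Along [a t -> b t] the rank [nu] increases, so the parity of the number of
   predecessors is a 2-colouring; [n] bounds the number of steps back. *)
Fixpoint even_depth a b (n : nat) (s : S) : Prop :=
  if n is n'.+1 then
    forall t : S, (b * t)%g = s -> (nu (a * t)%g < nu s)%N -> ~ even_depth a b n' (a * t)%g
  else True.

Lemma even_depth_stable a b n m s : (nu s < n)%N -> (nu s < m)%N ->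
  even_depth a b n s <-> even_depth a b m s.
Proof.
elim: n m s => // n IH [//|m] s; rewrite !ltnS => sn sm /=.
by split=> H t ts lt Hm; apply: (H t ts lt);
  apply/(IH m) => //; exact: leq_trans lt _.
Qed.

Lemma even_depth_flip a b (t : S) : (nu (a * t)%g < nu (b * t)%g)%N ->
  even_depth a b (nu (b * t)%g).+1 (b * t)%g <->
  ~ even_depth a b (nu (a * t)%g).+1 (a * t)%g.
Proof.
move=> lt; split=> [/(_ t erefl lt) H Ha|Ha u /mulg_injl -> _ H].
  by apply: H; apply/(@even_depth_stable a b _ (nu (a * t)%g).+1).
by apply: Ha; apply/(@even_depth_stable a b _ (nu (b * t)%g)).
Qed.

Lemma principal_mul_neq_lt a b (z : beta S) :
  z [set t | (nu (a * t)%g < nu (b * t)%g)%N] -> (principal a * z)%g <> (principal b * z)%g.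
Proof.
move=> zlt ab; pose P := [set s | even_depth a b (nu s).+1 s].
have Pb : z [set t | P (a * t)%g] <-> z [set t | P (b * t)%g].
  by rewrite -[z _]/((z : set S -> Prop) _); split=> /principal_mulE;
     [rewrite ab|rewrite -ab] => /principal_mulE.
have [zP|/betaC zP] := pselect (z [set t | P (a * t)%g]).
  have /(@filter_ex _ z)[t [[lt Pa] Pbt]] : z ([set t | (nu (a * t)%g < nu (b * t)%g)%N] `&`
      [set t | P (a * t)%g] `&` [set t | P (b * t)%g]).
    by apply/betaI; split; [apply/betaI|apply/Pb].
  by case: (even_depth_flip lt) => /(_ Pbt).
have zPb : z (~` [set t | P (b * t)%g]) by apply/betaC => /Pb; exact/betaC.
have /(@filter_ex _ z)[t [[lt Pa] Pbt]] : z ([set t | (nu (a * t)%g < nu (b * t)%g)%N] `&`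
    ~` [set t | P (a * t)%g] `&` ~` [set t | P (b * t)%g]).
  by apply/betaI; split => //; apply/betaI.
by apply: Pbt; apply/(even_depth_flip lt).
Qed.

Lemma principal_mul_free a b (z : beta S) :
  (principal a * z)%g = (principal b * z)%g -> a = b.
Proof.
move=> ab; apply: contrapT => nab.
have [|/betaC zge] := pselect (z [set t | (nu (a * t)%g < nu (b * t)%g)%N]).
  by move=> /principal_mul_neq_lt; exact.
apply: (@principal_mul_neq_lt b a z) => //; apply: betaS zge => t /= /negP.
rewrite -leqNgt leq_eqVlt => /orP[/eqP/nu_inj|//].
by move=> /mulg_injr ba; case: nab.
Qed.

End Countable.

End BetaTranslations.

Section SparseSequence.
Variable S : cancelSemigroupType.
Variable nu : S -> nat.
Hypothesis nu_inj : injective nu.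
Implicit Types (p q t w : beta S) (a b c d s : S).

Lemma remainder_setC1 q s : remainder q -> q (~` [set s]).
Proof. by move=> /remainderP qS; apply/betaC. Qed.

Lemma remainder_mulr_neq q a m : remainder q -> q [set b | (a * b)%g <> m].
Proof.
move=> qS; have [[b0 ab0]|nb] := pselect (exists b, (a * b)%g = m).
  apply: betaS (remainder_setC1 b0 qS) => b /= bb0 abm; apply: bb0.
  by apply: (@mulg_injl _ a); rewrite ab0.
by apply: betaS (betaT q) => b _ abm; apply: nb; exists b.
Qed.

Definition tail_set (b : nat -> S) N : set S := [set b n | n in [set n | (N <= n)%N]].

Lemma sparse_sequence (I : Type) (mu : I -> nat) (X : I -> set S) q0 :
  injective mu -> remainder q0 -> (forall i, q0 (X i)) ->
  exists b : nat -> S, [/\ injective b,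
    forall i n, (mu i <= n)%N -> X i (b n) &
    forall a c, a <> c -> exists N, forall x y,
      tail_set b N x -> tail_set b N y -> (c * x)%g <> (a * y)%g].
Proof.
move=> mu_inj q0S q0X.
have next (l : seq S) : exists b, [/\ forall i, (mu i < (size l).+1)%N -> X i b,
    forall m, List.In m l -> b <> m &
    forall a, (nu a < (size l).+1)%N -> forall c, (nu c < (size l).+1)%N ->
      forall m, List.In m l -> (a * b)%g <> (c * m)%g].
  have In_q0 (P : S -> set S) : (forall m, q0 (P m)) ->
      q0 [set b | forall m, List.In m l -> P m b].
    move=> qP; elim: l => [|m l IH]; first by apply: betaS (betaT q0) => b _ m [].
    apply: betaS (iffRL (betaI q0 _ _) (conj (qP m) IH)) => b [mb lb] m' /= [<-//|].
    exact: lb.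
  have h1 := beta_initial_segment (size l).+1 mu_inj q0X.
  have h2 := In_q0 (fun m => [set b | b <> m]) (fun m => remainder_setC1 m q0S).
  have h3 : q0 [set b | forall a, (nu a < (size l).+1)%N -> forall c, (nu c < (size l).+1)%N ->
      forall m, List.In m l -> (a * b)%g <> (c * m)%g].
    apply: (beta_initial_segment _ nu_inj (P := fun a => [set b | forall c,
      (nu c < (size l).+1)%N -> forall m, List.In m l -> (a * b)%g <> (c * m)%g])) => a.
    apply: (beta_initial_segment _ nu_inj (P := fun c => [set b |
      forall m, List.In m l -> (a * b)%g <> (c * m)%g])) => c.
    by apply: (In_q0 (fun m => [set b | (a * b)%g <> (c * m)%g])) => m;
      exact: remainder_mulr_neq.
  have [b [[b1 b2] b3]] := @filter_ex _ q0 _ _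
    (iffRL (betaI q0 _ _) (conj (iffRL (betaI q0 _ _) (conj h1 h2)) h3)).
  by exists b.
have [f fP] := choice next.
pose L := fix L n : seq S := if n is n'.+1 then f (L n') :: L n' else [::].
pose b n := f (L n).
have sL n : size (L n) = n by elim: n => //= n ->.
have inL m n : (m < n)%N -> List.In (b m) (L n).
  elim: n => // n IH; rewrite ltnS leq_eqVlt => /orP[/eqP->|/IH]; [by left|by right].
have blt m n : (m < n)%N -> b n <> b m.
  by move=> mn; have [_ + _] := fP (L n); apply; exact: inL.
exists b; split=> [m n bmn|i n|a c ac].
- by have [/blt|/blt|//] := ltngtP m n; rewrite bmn.
- by move=> mn; have [+ _ _] := fP (L n); apply; rewrite sL ltnS.
- exists (maxn (nu a) (nu c)) => _ _ [n /= + <-] [m /= + <-].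
  rewrite !geq_max => /andP[an cn] /andP[am cm].
  have [mn|nm|nm] := ltngtP m n.
  + by have [_ _ +] := fP (L n); apply; rewrite ?sL ?ltnS//; exact: inL.
  + move=> E; have [_ _ +] := fP (L m); move=> /(_ a _ c _ (b n)); rewrite sL !ltnS.
    by move=> /(_ am cm (inL _ _ nm)); apply; rewrite E.
  + by rewrite nm => /mulg_injr ca; exact: ac.
Qed.

Lemma tail_remainder (b : nat -> S) : injective b ->
  exists2 q, remainder q & forall N, q (tail_set b N).
Proof.
move=> b_inj; pose F := filter_from [set: nat] (tail_set b).
have FF : ProperFilter F.
  apply: filter_from_proper; last by move=> N _; exists (b N); exists N => /=.
  apply: filter_from_filter; first by exists 0%N.
  move=> M N _ _; exists (maxn M N) => // _ [n /= + <-]; rewrite geq_max => /andP[Mn Nn].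
  by split; exists n.
have [W [WU FW]] := ultraFilterLemma FF.
have Wt N : W (tail_set b N) by apply: FW; exists N.
exists (Beta WU) => //; apply/remainderP => s Ws.
have [n bn] : exists n, b n = s.
  have /(@filter_ex _ (Beta WU))[_ [-> [n _ bn]]] :
    Beta WU ([set s] `&` tail_set b 0) by apply/betaI; split=> //; exact: Wt.
  by exists n.
have /(@filter_ex _ (Beta WU))[_ [-> [m /= nm bm]]] :
    Beta WU ([set s] `&` tail_set b n.+1) by apply/betaI; split=> //; exact: Wt.
by move: nm; rewrite (b_inj m n) ?ltnn// bm.
Qed.

Lemma remainder_tail (b : nat -> S) q : remainder q -> q (tail_set b 0) ->
  forall N, q (tail_set b N).
Proof.
move=> qS q0; elim=> // N IH.
apply: betaS (iffRL (betaI q _ _) (conj IH (remainder_setC1 (b N) qS))).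
move=> _ [[n /= Nn <-] nbN]; exists n => //=; rewrite ltn_neqAle Nn andbT.
by apply/eqP => Nn'; apply: nbN; rewrite Nn'.
Qed.

Lemma remainder_or_principal q : remainder q \/ exists s, q = principal s.
Proof.
have [|nq] := pselect (remainder q); first by left.
have [s _ <-] : range (@principal S) q by exact: contrapT.
by right; exists s.
Qed.

Section Choice.
Variables (Sigma : set (beta S)) (sigma : beta S -> nat) (p q0 : beta S).
Hypothesis sigma_inj : {in Sigma &, injective sigma}.
Hypothesis Sigmap : Sigma p.
Hypothesis q0S : remainder q0.
Hypothesis Sigma_q0 : forall (s r : beta S) d x, Sigma s -> Sigma r ->
  (principal d * s)%g <> (x * (q0 * r))%g.

Lemma separating_sequence : exists b : nat -> S, [/\ injective b,
  forall q, remainder q -> (forall N, q (tail_set b N)) ->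
    forall (s r : beta S) d x, Sigma s -> Sigma r -> (principal d * s)%g <> (x * (q * r))%g &
  forall a c, a <> c -> exists N, forall x y,
      tail_set b N x -> tail_set b N y -> (c * x)%g <> (a * y)%g].
Proof.
have exA (dsr : S * beta S * beta S) : exists A : set S,
    let: (d, s, r) := dsr in Sigma s -> Sigma r -> (principal d * s)%g A /\
      forall c, ~ (principal c * (q0 * r))%g A.
  case: dsr => [[d s] r]; have [Ss|] := pselect (Sigma s); last by exists setT.
  have [Sr|] := pselect (Sigma r); last by exists setT.
  apply: contrapT => /forallNP nA.
  have [A dsA|x _ xP] := @closure_ultrafilter S S (principal d * s)%g
      (fun c => (principal c * (q0 * r))%g) setT.
    apply: contrapT => nc; apply: (nA A) => _ _; split=> // c cA.
    by apply: nc; exists c.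
  apply: (@Sigma_q0 s r d x) => //; apply: betaP => A /xP xA.
  by apply/beta_mul_liml.
have [A AP] := choice exA.
pose I : Type := (S * {s | Sigma s} * {r | Sigma r} * S)%type.
pose mu (i : I) : nat := let: (d, s, r, c) := i in
  choice.pickle (nu d, sigma (sval s), sigma (sval r), nu c).
have sval_inj (s r : {s | Sigma s}) : sigma (sval s) = sigma (sval r) -> s = r.
  move=> E; have : sval s = sval r.
    by apply: sigma_inj => //; apply/mem_set; exact: svalP.
  by move: s r {E} => [s Ss] [r Sr] /= sr; subst r; congr exist; exact: Prop_irrelevance.
have mu_inj : injective mu.
  move=> [[[d s] r] c] [[[d' s'] r'] c'] /(pcan_inj choice.pickleK)[/nu_inj-> /sval_inj->].
  by move=> /sval_inj-> /nu_inj->.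
pose X (i : I) : set S := let: (d, s, r, c) := i in
  [set b | ~ (principal (c * b)%g * sval r)%g (A (d, sval s, sval r))].
have q0X i : q0 (X i).
  case: i => [[[d [s Ss]] [r Sr]] c]; apply/betaC => H.
  have [_ /(_ c)] := AP (d, s, r) Ss Sr; apply; exact/beta_mul_limm.
have [b [b_inj bX bN]] := sparse_sequence mu_inj q0S q0X.
exists b; split=> // q qS qb s r d x Ss Sr dsx.
have [dsA _] := AP (d, s, r) Ss Sr.
move: dsA; rewrite dsx => /beta_mul_liml/(@filter_ex _ x)[c /= /beta_mul_limm qA].
pose i : I := (d, exist _ s Ss, exist _ r Sr, c).
have /(@filter_ex _ q)[_ [[n /= mun <-] cb]] := iffRL (betaI q _ _) (conj (qb (mu i)) qA).
exact: (bX i n mun).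
Qed.

Lemma separating_point : exists q, [/\ remainder q,
  forall (s r t w : beta S), Sigma s -> Sigma r -> (t * (q * s))%g = (w * (q * r))%g ->
    exists a c, (principal a * s)%g = (principal c * r)%g &
  forall t w, (t * (q * p))%g = (w * (q * p))%g -> t = w].
Proof.
have [b [b_inj bS bN]] := separating_sequence.
have [q qS qb] := tail_remainder b_inj.
have qSep := bS q qS qb.
(* either the limit point is free, hence excluded, or it is a term of the sequence *)
have limP a (s r : beta S) c N q'' : Sigma s -> Sigma r -> q'' (tail_set b N) ->
    (forall A, (principal c * r)%g A -> q'' [set b' | (principal (a * b')%g * s)%g A]) ->
    exists2 b', tail_set b N b' & (principal c * r)%g = (principal (a * b')%g * s)%g.
  move=> Ss Sr q''b crP.
  have E : (principal c * r)%g = (principal a * (q'' * s))%g.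
    by apply: betaP => A /crP crA; apply/beta_mul_limm.
  have [q''S|[b' q''E]] := remainder_or_principal q''.
    exfalso; apply: (bS q'' q''S _ r s c (principal a)) => //.
    apply: remainder_tail => //; apply: betaS q''b => _ [n _ <-]; by exists n.
  exists b'; last by rewrite E q''E mulgA principalM.
  by move: q''b; rewrite q''E => /principalE.
have crossP a c N q' (s r : beta S) : Sigma s -> Sigma r ->
    q' (tail_set b N) -> (principal c * (q * r))%g = (principal a * (q' * s))%g ->
    exists b1 b2, [/\ tail_set b N b1, tail_set b N b2 &
      (principal (c * b1)%g * r)%g = (principal (a * b2)%g * s)%g].
  move=> Ss Sr q'b E.
  have [|[b1 tb1 [q'' q''b H]]|[b2 tb2 [q'' q''b H]]] := @ultrafilter_separation S S S nu nu q q'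
      (fun b1 => (principal (c * b1)%g * r)%g) (fun b2 => (principal (a * b2)%g * s)%g)
      _ _ nu_inj nu_inj (qb N) q'b.
  - by move=> A /beta_mul_limm; rewrite E => /beta_mul_limm.
  - by have [b2 tb2 E2] := limP _ _ _ _ _ _ Ss Sr q''b H; exists b1, b2.
  - by have [b1 tb1 E2] := limP _ _ _ _ _ _ Sr Ss q''b H; exists b1, b2.
have halfP (E : set S) a w (s r : beta S) : Sigma s -> Sigma r -> w E ->
    (principal a * (q * s))%g = (w * (q * r))%g ->
    exists c q', [/\ E c, q' (tail_set b 0) &
      (principal c * (q * r))%g = (principal a * (q' * s))%g].
  move=> Ss Sr wE Eq.
  have [|[b' _ [w' _ H]]|[c Ec [q' q'b H]]] := @ultrafilter_separation S S S nu nu q w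
      (fun b' => (principal (a * b')%g * s)%g) (fun c => (principal c * (q * r))%g)
      _ _ nu_inj nu_inj (qb 0%N) wE.
  - by move=> A /beta_mul_limm; rewrite Eq => /beta_mul_liml.
  - exfalso; apply: (@qSep s r (a * b')%g w') => //.
    by apply: betaP => A /H wA; apply/beta_mul_liml.
  - exists c, q'; split=> //; apply: betaP => A /H qA; exact/beta_mul_limm.
have sepP t w (s r : beta S) (D E : set S) : t D -> w E -> (t * (q * s))%g = (w * (q * r))%g ->
    (exists a w', [/\ D a, w' E & (principal a * (q * s))%g = (w' * (q * r))%g]) \/
    (exists c t', [/\ E c, t' D & (principal c * (q * r))%g = (t' * (q * s))%g]).
  move=> tD wE Eq.
  have [|[a Da [w' w'E H]]|[c Ec [t' t'D H]]] := @ultrafilter_separation S S S nu nu t w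
      (fun a => (principal a * (q * s))%g) (fun c => (principal c * (q * r))%g)
      _ _ nu_inj nu_inj tD wE.
  - by move=> A /beta_mul_liml; rewrite Eq => /beta_mul_liml.
  - left; exists a, w'; split=> //; apply: betaP => A /H wA; exact/beta_mul_liml.
  - right; exists c, t'; split=> //; apply: betaP => A /H wA; exact/beta_mul_liml.
exists q; split=> // [s r t w Ss Sr|t w].
  have rel (s' r' : beta S) a w' : Sigma s' -> Sigma r' ->
      (principal a * (q * s'))%g = (w' * (q * r'))%g ->
      exists a c, (principal a * s')%g = (principal c * r')%g.
    move=> Ss' Sr' /(halfP setT _ _ _ _ Ss' Sr' (betaT w'))[c [q' [_ q'b Eq]]].
    have [b1 [b2 [_ _ E12]]] := crossP _ _ _ _ _ _ Ss' Sr' q'b Eq.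
    by exists (a * b2)%g, (c * b1)%g.
  move=> /(sepP _ _ _ _ _ _ (betaT t) (betaT w))[[a [w' [_ _ /rel]]]|[c [t' [_ _ /rel]]]].
    exact.
  by move=> /(_ Sr Ss)[a [c' E]]; exists c', a.
have cancel (E : set S) a w' : w' E -> ~ E a ->
    (principal a * (q * p))%g = (w' * (q * p))%g -> False.
  move=> wE nEa /(halfP E _ _ _ _ Sigmap Sigmap wE)[c [q' [Ec q'b Eq]]].
  have ac : a <> c by move=> ac; rewrite ac in nEa.
  have [q'S|[b' q'E]] := remainder_or_principal q'; last first.
    apply: (@qSep p p (a * b')%g (principal c)) => //.
    by rewrite Eq q'E mulgA principalM.
  have [N NP] := bN a c ac.
  have q'N := remainder_tail q'S q'b N.
  have [b1 [b2 [tb1 tb2 /(principal_mul_free nu_inj)]]] :=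
    crossP _ _ _ _ _ _ Sigmap Sigmap q'N Eq.
  exact: NP.
move=> Eq; apply: betaP => D tD; apply: contrapT => /betaC wD.
have [[a [w' [Da w'D]]]|[c [t' [Dc t'D]]]] := sepP _ _ _ _ _ _ tD wD Eq.
  by apply: cancel w'D _; apply.
by apply: cancel t'D _.
Qed.

End Choice.
End SparseSequence.

(** * Minimal idempotents *)

Section MinimalIdempotent.
Variables (T : semigroupType) (e : T).
Hypothesis ee : (e * e)%g = e.
Hypothesis emin : forall x : T, exists y : T, (y * x * e)%g = e.
Implicit Types x y : T.

Definition corner : set T := [set x | (e * x)%g = x /\ (x * e)%g = x].

Lemma corner_id : corner e. Proof. by split. Qed.

Lemma cornerM x y : corner x -> corner y -> corner (x * y)%g.
Proof. by move=> [ex _] [_ ye]; split; [rewrite mulgA ex|rewrite -mulgA ye]. Qed.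

Lemma corner_conj x : corner (e * x * e)%g.
Proof. by split; rewrite ?mulgA ?ee// -mulgA ee. Qed.

Lemma corner_left_inverse x : corner x -> exists2 y, corner y & (y * x)%g = e.
Proof.
move=> [ex xe]; have [y yx] := emin x.
exists (e * y * e)%g; first exact: corner_conj.
have yxe : (y * x)%g = e by rewrite -[in LHS]xe mulgA.
by rewrite -!mulgA ex yxe ee.
Qed.

Lemma corner_inverse : exists inv : T -> T, [/\ involutive inv,
  forall x, corner x -> corner (inv x) & forall x, corner x -> (inv x * x)%g = e].
Proof.
have ex x : exists y, corner x -> corner y /\ (y * x)%g = e.
  have [Hx|nHx] := pselect (corner x); last by exists x.
  by have [y Hy yx] := corner_left_inverse Hx; exists y.
have [f fP] := choice ex.
pose inv x := if `[< corner x >] then f x else x.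
have invE x : corner x -> inv x = f x by rewrite /inv => Hx; rewrite asboolT.
have ff x : corner x -> f (f x) = x.
  move=> Hx; have [Hfx fx] := fP x Hx; have [Hffx ffx] := fP _ Hfx.
  case: (Hx) => [ex0 _]; case: (Hffx) => [_ ffe].
  by rewrite -[RHS]ex0 -ffx -mulgA fx ffe.
exists inv; split=> [x|x Hx|x Hx].
- have [Hx|nHx] := pselect (corner x).
    by rewrite !invE ?ff//; case: (fP x Hx).
  by rewrite /inv asboolF// asboolF.
- by rewrite invE//; case: (fP x Hx).
- by rewrite invE//; case: (fP x Hx).
Qed.

Lemma min_ideal_principalE : @min_ideal T = [set z | exists x y, z = (x * e * y)%g].
Proof.
apply: min_idealP.
  split; first by exists (e * e * e)%g, e, e.
  move=> _ t [x [y ->]]; split; first by exists x, (y * t)%g; rewrite !mulgA.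
  by exists (t * x)%g, y; rewrite !mulgA.
move=> I [[s Is] Ii] _ [x [y ->]].
have [z ze] := emin s.
suff Ie : I e by have [+ _] := Ii _ y (proj2 (Ii _ x Ie)).
by rewrite -ze; have [+ _] := Ii _ e (proj2 (Ii _ z Is)).
Qed.

Lemma min_idealM x y : min_ideal x -> min_ideal (x * y)%g /\ min_ideal (y * x)%g.
Proof. by move=> Kx; split=> I Ii; have [] := Ii.2 x y (Kx I Ii). Qed.

Lemma min_ideal_left_identity x : min_ideal x ->
  exists2 d, min_ideal d & (d * x)%g = x.
Proof.
rewrite min_ideal_principalE => -[a [b ->]].
have [i _ ie] := corner_left_inverse (corner_conj (b * a)%g).
exists (a * e * (i * e * b))%g; first by exists a, (i * e * b)%g.
transitivity (a * e * (i * (e * (b * a) * e)) * b)%g; first by rewrite !mulgA.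
by rewrite ie -[(a * e * e)%g]mulgA ee.
Qed.

Section L1.
Variable R : realType.
Implicit Types f g h : l1 R T.

Lemma conv_delta_on f x y t : (l1_delta R x \star f \star l1_delta R y) t != 0 ->
  exists2 s, f s != 0 & t = (x * s * y)%g.
Proof.
apply: contraNP => ns; rewrite conv_at; apply/eqP.
rewrite pairing_conv; last first.
  by apply: (@bounded_kernel R _ _ _ (fun s r : T => if (r * s)%g == t then 1 else 0));
    exact: (@bounded_indic R _ (fun xy : T * T => (xy.2 * xy.1)%g == t)).
rewrite pairing_delta pairing0// => s fs; rewrite pairing_delta; case: eqP => // E.
by case: ns; exists s.
Qed.

Lemma conv_on_ideall (I : set T) f g : (forall x y, I y -> I (x * y)%g) ->
  l1_on I f -> l1_on I (g \star f).
Proof.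
move=> II fI t; have [//|nIt] := pselect (I t).
rewrite conv_at pairing0 ?eqxx// => r _; apply: pairing0 => s /fI Is.
by case: eqP => // rst; case: nIt; rewrite -rst; exact: II.
Qed.

Lemma conv_on_idealr (I : set T) f g : (forall x y, I x -> I (x * y)%g) ->
  l1_on I f -> l1_on I (f \star g).
Proof.
move=> II fI t; have [//|nIt] := pselect (I t).
rewrite conv_at pairing0 ?eqxx// => r /fI Ir; apply: pairing0 => s _.
by case: eqP => // rst; case: nIt; rewrite -rst; exact: II.
Qed.

Lemma conv_sandwich_eq0 (I : set T) f g h :
  (forall x y, I x -> I y -> l1_delta R x \star f \star l1_delta R y = 0) ->
  l1_on I g -> l1_on I h -> g \star f \star h = 0.
Proof.
move=> f0 gI hI; apply: pairing_ext => chi /[dup] chiB [C chiC].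
rewrite pairing_conv// [RHS]pairing0; last by move=> t; rewrite l1_zero eqxx.
rewrite pairing_swap; last by exists C => xy; exact: chiC.
apply: pairing0 => y /hI Iy; rewrite pairing_conv; last by exists C.
apply: pairing0 => x /gI Ix.
transitivity (pairing (l1_delta R x \star f \star l1_delta R y) chi); last first.
  by rewrite f0// pairing0// => t; rewrite l1_zero eqxx.
rewrite pairing_conv// pairing_conv ?pairing_delta; last first.
  by apply: (@bounded_kernel R _ _ _ (fun s r => chi (r * s)%g)); exists C => xy; exact: chiC.
by apply: eq_pairing => s _; rewrite pairing_delta.
Qed.

Lemma jacobson_min_ideal_sandwich f x y : jacobson_radical (@conv R T) f ->
  min_ideal x -> min_ideal y -> l1_delta R x \star f \star l1_delta R y = 0.
Proof.
rewrite min_ideal_principalE => Jf [a [b ->]] [c [d ->]].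
have [inv [invK invH Hvl]] := corner_inverse.
pose u := l1_delta R (e * b)%g; pose v := l1_delta R (c * e)%g.
pose k := u \star f \star v.
have kH : l1_on corner k.
  move=> t /conv_delta_on[s _ ->].
  have -> : (e * b * s * (c * e) = e * (b * s * c) * e)%g by rewrite !mulgA.
  exact: corner_conj.
have Hl x0 : corner x0 -> (e * x0)%g = x0 by case.
have Hr x0 : corner x0 -> (x0 * e)%g = x0 by case.
suff k0 : k = 0.
  have -> : (a * e * b)%g = (a * (e * b))%g by rewrite mulgA.
  rewrite -[l1_delta R (a * _)%g]l1_deltaM -[l1_delta R (c * e * d)%g]l1_deltaM.
  rewrite -/u -/v !convA -[_ \star u \star f]convA -[_ \star (u \star f) \star v]convA.
  by rewrite -/k k0 conv0r conv0l.
apply: (@pos_quasi_invertible_eq0 R T corner e inv corner_id cornerM Hl Hr invH invK Hvl k kH) => r.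
pose ks := l1_star invK k; pose h := ks \star k.
have [g gE] := jacobson_left_quasi_inverse (@convA R T) (@convDZl R T) (@convDZr R T)
  (r%:C *: (v \star ks \star u)) Jf.
pose Z := ks \star u \star f \star g \star v.
have kse : l1_delta R e \star ks = ks.
  by apply: (conv_unitl Hl); exact: (l1_on_star invH).
have ZE : Z = r%:C *: ((h + Z) \star h).
  rewrite {1}/Z gE !(convZl, convZr, convDr, convDl) -scalerDr.
  by rewrite /h /Z /k !convA.
exists (r%:C *: (h + Z)); last first.
  by rewrite convZl -ZE scalerDr.
apply: l1_onZ => t.
have -> : h + Z = l1_delta R e \star (ks \star u \star f + ks \star u \star f \star g) \star v.
  by rewrite convDr !convDl !convA kse /h /k !convA.
move=> /conv_delta_on[s _ ->]; rewrite mulgA.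
have -> : (e * s * c * e = e * (s * c) * e)%g by rewrite !mulgA.
exact: corner_conj.
Qed.

End L1.
End MinimalIdempotent.

(** * The support of an element of the radical *)

Lemma star_remainder (S : Type) (p : star S) : @remainder S (val p).
Proof. exact: set_mem (valP p). Qed.
Arguments star_remainder {S} p _.

Section Remainder.
Variable S : cancelSemigroupType.
Implicit Types (x y : beta S) (p q : star S).

Lemma closed_remainder : closed (@remainder S).
Proof.
rewrite /remainder -openC setCK.
have -> : range (@principal S) = \bigcup_(s in setT) beta_basic [set s].
  apply/seteqP; split=> [_ [s _ <-]|x [s _ xs]].
    by exists s => //; apply/principalE.
  by apply: contrapT => /remainderP/(_ s).
by apply: bigcup_open => s _; exact: beta_basic_open.
Qed.

Lemma remainder_mull x y : remainder y -> remainder (x * y)%g.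
Proof.
move=> /remainderP yS; apply/remainderP => u /beta_mulE/(@filter_ex _ x)[s /= ys].
have [t /= stu] := @filter_ex _ y _ _ ys.
by apply: (yS t); apply: betaS ys => t' /=; rewrite -stu => /mulg_injl.
Qed.

Lemma star_valM p q : val (p * q)%g = (val p * val q)%g.
Proof. by []. Qed.

Lemma remainder_star x : remainder x -> exists p, val p = x.
Proof. by move=> xS; exists (exist _ x (mem_set xS)). Qed.

Lemma star_minimal_idempotent p :
  exists e : star S, (e * e)%g = e /\ forall x : star S, exists y : star S, (y * x * e)%g = e.
Proof.
have [||e [eS ee emin]] := minimal_left_idempotent closed_remainder.
- by exists (val p); exact: star_remainder.
- by move=> x y _; exact: remainder_mull.
have [f fE] := remainder_star eS; exists f; split=> [|x].
  by apply: val_inj; rewrite star_valM fE.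
have [y yS yE] := emin _ (star_remainder x).
have [g gE] := remainder_star yS; exists g.
by apply: val_inj; rewrite !star_valM fE gE.
Qed.

End Remainder.

Section SupportInMinIdeal.
Variables (R : realType) (S : cancelSemigroupType) (nu : S -> nat).
Hypothesis nu_inj : injective nu.
Hypothesis mulSC : forall s t : S, (s * t)%g = (t * s)%g.
Variable f : l1 R (star S).
Variables (p e : star S).
Hypothesis ee : (e * e)%g = e.
Hypothesis emin : forall x : star S, exists y : star S, (y * x * e)%g = e.
Hypothesis fp : f p != 0.
Hypothesis npK : ~ min_ideal p.

Let P := @principal S.
Let PC a (z : beta S) : (P a * z = z * P a)%g. Proof. exact: principal_mulC. Qed.
Let PM a b : P (a * b)%g = (P a * P b)%g. Proof. exact: principalM. Qed.
Let PCA a (y z : beta S) : (P a * (y * z) = y * (P a * z))%g.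
Proof. by rewrite !mulgA PC. Qed.

Definition support_outside : set (beta S) := [set val s | s in [set s | f s != 0 /\ ~ min_ideal s]].

Lemma principal_mul_min_ideal (a : S) (s z : star S) : (P a * val s)%g = val z ->
  min_ideal z -> min_ideal s.
Proof.
move=> sz /(min_ideal_left_identity ee emin)[d Kd dz].
suff <- : (d * s)%g = s by case: (min_idealM s Kd).
apply: val_inj; rewrite star_valM; apply: (@principal_mul_inj _ a).
by rewrite /= -/P PCA sz -star_valM dz.
Qed.

Lemma support_point : exists q : star S,
  (forall (s r : star S) (t w : beta S), f s != 0 -> ~ min_ideal s ->
    f r != 0 -> ~ min_ideal r ->
    (t * (val q * val s))%g = (w * (val q * val r))%g ->
    exists a c, (P a * val s)%g = (P c * val r)%g) /\
  (forall t w, (t * (val q * val p))%g = (w * (val q * val p))%g -> t = w).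
Proof.
have /countable_injP[sigma sigma_inj] : countable support_outside.
  apply: (sub_countable _ (supp_countable f)).
  apply: card_le_trans (card_image_le _ _) _.
  by apply: subset_card_le => s [].
have Sp : support_outside (val p) by exists p.
have [|q [qS qsep qcancel]] := separating_point nu_inj sigma_inj Sp (star_remainder e).
  move=> _ _ d x [s [fs nKs] <-] [r [fr nKr] <-] dsx; apply: nKs.
  have [z zE] := remainder_star (@remainder_mull _ x _ (star_remainder e)).
  apply: (@principal_mul_min_ideal d s (z * e * r)%g).
    rewrite -/P in dsx; rewrite dsx !star_valM zE !mulgA; congr (_ * _)%g.
    by rewrite -[RHS]mulgA -star_valM ee.
  by rewrite (min_ideal_principalE emin); exists z, r.
have [u uE] := remainder_star qS; exists u; rewrite uE; split=> // s r t w fs nKs fr nKr.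
by apply: qsep; [exists s|exists r].
Qed.

Section Powers.
Variable q : star S.
Hypothesis qsep : forall (s r : star S) (t w : beta S), f s != 0 -> ~ min_ideal s ->
    f r != 0 -> ~ min_ideal r ->
    (t * (val q * val s))%g = (w * (val q * val r))%g ->
    exists a c, (P a * val s)%g = (P c * val r)%g.
Hypothesis qcancel : forall t w,
  (t * (val q * val p))%g = (w * (val q * val p))%g -> t = w.
Let u : star S := (q * p)%g.

Definition upow n : star S := iter n (fun w => w * u)%g u.
Definition shifted_upow c n : beta S := iter n (fun w => w * val u)%g (P c).

Lemma shifted_upowS c n : shifted_upow c n.+1 = (P c * val (upow n))%g.
Proof.
elim: n => // n IH.
by rewrite -[LHS]/(shifted_upow c n.+1 * val u)%g IH -mulgA -star_valM.
Qed.

Lemma principal_shifted_upow a c n :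
  (P a * shifted_upow c n)%g = shifted_upow (a * c)%g n.
Proof.
elim: n => [|n IH]; first by rewrite [RHS]PM.
by rewrite -[shifted_upow c n.+1]/(shifted_upow c n * val u)%g mulgA IH.
Qed.

Lemma shifted_upow_strip d c n : (d * shifted_upow c n)%g = shifted_upow c n ->
  (d * P c)%g = P c.
Proof.
elim: n => // n IH; rewrite -[shifted_upow c n.+1]/(shifted_upow c n * val u)%g mulgA.
by rewrite star_valM => /qcancel.
Qed.

Lemma min_ideal_neq_upow w c n (s : star S) : min_ideal s ->
  (w * (val q * val s))%g <> shifted_upow c n.
Proof.
move=> Ks E; have [z zE] := remainder_star (@remainder_mull _ w _ (star_remainder q)).
have [d _ ds] := min_ideal_left_identity ee emin (proj2 (min_idealM z Ks)).
have /shifted_upow_strip : (val d * shifted_upow c n)%g = shifted_upow c n.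
  have zs : (w * (val q * val s))%g = val (z * s)%g by rewrite star_valM zE mulgA.
  by rewrite -E zs -star_valM ds.
rewrite -PC => dc; apply: (remainder_mull (x := P c) (star_remainder d)).
by exists c.
Qed.

Definition orbit_p (s : star S) := exists a c, (P a * val s)%g = (P c * val p)%g.
Definition orbit_upow n (y : star S) := exists a c, (P a * val y)%g = shifted_upow c n.+1.

Lemma upow_factor w c n s : f s != 0 ->
  (w * (val q * val s))%g = shifted_upow c n.+1 ->
  exists a' c', (P a' * val s)%g = (P c' * val p)%g /\
    (P c' * w)%g = shifted_upow (a' * c)%g n.
Proof.
move=> fs E; have nKs : ~ min_ideal s by move=> /(@min_ideal_neq_upow w c n.+1).
have [a' [c' ac]] := qsep fs nKs fp npK E; exists a', c'; split=> //.
apply: qcancel; rewrite -principal_shifted_upow -mulgA -[RHS]mulgA.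
rewrite -[(val q * val p)%g]/(val u) -[(shifted_upow c n * _)%g]/(shifted_upow c n.+1).
rewrite -E PCA [in RHS]PCA star_valM; congr (_ * _)%g.
by rewrite PCA -ac [in RHS]PCA.
Qed.

Variable inv : star S -> star S.
Hypothesis invK : involutive inv.
Hypothesis invH : forall x, corner e x -> corner e (inv x).
Hypothesis Hvl : forall x, corner e x -> (inv x * x)%g = e.

Definition ratio (y z : star S) : star S := (e * y * (e * inv (e * z * e)))%g.

Lemma corner_ratio y z : corner e (ratio y z).
Proof.
rewrite /ratio; have := invH (corner_conj ee z); set i := inv _ => -[ei ie].
by split; [rewrite !mulgA ee|rewrite -!mulgA ie].
Qed.

Lemma ratio_eq a c (y z : star S) : (P a * val y)%g = (P c * val z)%g ->
  (P a * val (ratio y z))%g = (P c * val e)%g.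
Proof.
have Hz := corner_conj ee z.
have zE : (e * z * (e * inv (e * z * e)))%g = e.
  by rewrite mulgA -{1}(invK (e * z * e)%g) Hvl//; exact: invH.
move=> yz; rewrite -[in RHS]zE /ratio !star_valM -!mulgA !(PCA _ (val e)).
by congr (_ * _)%g; rewrite !mulgA yz.
Qed.

Lemma ratio_unique a c (x y : star S) : (P a * val x)%g = (P c * val e)%g ->
  (P a * val y)%g = (P c * val e)%g -> x = y.
Proof.
by move=> <- yE; apply: val_inj; apply: (@principal_mul_inj _ a); rewrite yE.
Qed.

Lemma orbit_step n (t s : star S) : orbit_upow n t -> orbit_p s ->
  orbit_upow n.+1 (t * (q * s))%g /\
  ratio (t * (q * s))%g (upow n.+1) = (ratio s p * ratio t (upow n))%g.
Proof.
move=> [a [c ac]] [a' [c' ac']].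
have E : (P (a' * a)%g * val (t * (q * s))%g)%g = shifted_upow (c' * c)%g n.+2.
  rewrite PM !star_valM -mulgA [(P a * _)%g]mulgA ac PCA PCA ac'.
  rewrite -principal_shifted_upow.
  rewrite -[shifted_upow c n.+2]/(shifted_upow c n.+1 * (val q * val p))%g [RHS]PCA.
  by congr (_ * _)%g; rewrite [RHS]PCA.
split; first by exists (a' * a)%g, (c' * c)%g.
apply: (@ratio_unique (a' * a)%g (c' * c)%g).
  by apply: ratio_eq; rewrite E shifted_upowS.
have r1 := ratio_eq ac'; rewrite shifted_upowS in ac; have r2 := ratio_eq ac.
rewrite star_valM PM -mulgA [(P a * (_ * _))%g]PCA r2 mulgA r1 -mulgA.
by rewrite -[(val e * (P c * _))%g]PCA -star_valM ee mulgA -PM.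
Qed.

Lemma orbit_step0 (s : star S) : orbit_p s ->
  orbit_upow 0 (q * s)%g /\ ratio (q * s)%g (upow 0) = ratio s p.
Proof.
move=> [a [c ac]].
have E : (P a * val (q * s)%g)%g = (P c * val u)%g.
  by rewrite !star_valM PCA ac PCA.
split; first by exists a, c.
by apply: (@ratio_unique a c); exact: ratio_eq.
Qed.

Lemma orbit_upowS n (t s : star S) : f s != 0 -> orbit_upow n.+1 (t * (q * s))%g ->
  orbit_upow n t /\ orbit_p s.
Proof.
move=> fs [a [c]]; rewrite !star_valM mulgA => /(upow_factor fs)[a' [c' [ac' E]]].
split; last by exists a', c'.
by exists (c' * a)%g, (a' * c)%g; rewrite PM -mulgA.
Qed.

Lemma principal_not_remainder a : ~ remainder (P a).
Proof. by apply; exists a. Qed.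

Lemma orbit_upow0 (t s : star S) : f s != 0 -> ~ orbit_upow 0 (t * (q * s))%g.
Proof.
move=> fs [a [c]]; rewrite !star_valM mulgA => /(upow_factor fs)[a' [c' [_ E]]].
apply: (@principal_not_remainder (a' * c)%g); rewrite -[P _]/(shifted_upow (a' * c)%g 0) -E.
by rewrite mulgA; apply: remainder_mull; exact: star_remainder.
Qed.

Lemma orbit_upow_q n (s : star S) : f s != 0 -> orbit_upow n (q * s)%g -> orbit_p s /\ n = 0%N.
Proof.
move=> fs [a [c]]; rewrite !star_valM => /(upow_factor fs)[a' [c' [ac' E]]].
split; first by exists a', c'.
case: n E => // n; rewrite shifted_upowS -PM => E; exfalso.
apply: (@principal_not_remainder (c' * a)%g); rewrite E.
by apply: remainder_mull; exact: star_remainder.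
Qed.

Lemma mask_summable : (fun s => if `[< orbit_p s >] then f s else 0 : R[i]^o) \in @l1_pred R (star S).
Proof.
apply/l1P; apply: le_lt_trans (l1_abs_summable f); apply: le_esum => s _.
by rewrite lee_fin; case: ifP => _ //; rewrite Normc.normc0 normc_ge0.
Qed.

Definition orbit_part : l1 R (star S) := l1_delta R e \star L1 mask_summable \star
  l1_delta R (e * inv (e * p * e))%g.

Lemma pairing_orbit_part (psi : star S -> R[i]) : bounded_fun psi ->
  pairing orbit_part psi =
  pairing f (fun s => if `[< orbit_p s >] then psi (ratio s p) else 0).
Proof.
move=> [C psiC]; rewrite pairing_conv; last by exists C.
rewrite pairing_conv; last first.
  by apply: (@bounded_kernel R _ _ _ (fun s r => psi (r * s)%g)); exists C => xy; exact: psiC.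
rewrite pairing_delta.
transitivity (pairing (L1 mask_summable) (fun s => psi (ratio s p))).
  by apply: eq_pairing => s _; rewrite pairing_delta.
apply: eq_csum => s _ /=; by case: ifP => _; rewrite ?mul0r ?mulr0.
Qed.

Lemma orbit_part_on : l1_on (corner e) orbit_part.
Proof. by move=> t /conv_delta_on[s _ ->]; exact: corner_ratio. Qed.

Lemma orbit_part_supp t : orbit_part t != 0 -> exists2 s, orbit_p s & t = ratio s p.
Proof.
move=> /conv_delta_on[s /=]; case: ifPn => [/asboolP Os _ ->|_]; first by exists s.
by rewrite eqxx.
Qed.

Lemma orbit_part_id : orbit_part e = f p.
Proof.
rewrite -pairing_indic pairing_orbit_part; last exact: bounded_indic.
rewrite -[RHS]pairing_indic; apply: eq_pairing => s fs.
have [a _] := @filter_ex _ (val p) _ _ (betaT (val p)).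
have [->|sp] := eqVneq s p.
  rewrite asboolT; last by exists a, a.
  have -> : ratio p p = e by apply: (@ratio_unique a a) => //; exact: ratio_eq.
  by rewrite eqxx.
case: ifPn => // /asboolP[b [c bc]]; case: eqP => // re.
have := ratio_eq bc; rewrite re => /(principal_mul_free nu_inj) E.
move: bc; rewrite E => /principal_mul_inj/val_inj ps.
by rewrite ps eqxx in sp.
Qed.

Lemma orbit_part_central t x : orbit_part t != 0 -> corner e x -> (t * x = x * t)%g.
Proof.
move=> /orbit_part_supp[s [a [c /ratio_eq ac]] ->] [ex xe].
apply: val_inj; apply: (@principal_mul_inj _ a); rewrite -/P.
rewrite -[LHS]/(P a * (val (ratio s p) * val x))%g.
rewrite -[RHS]/(P a * (val x * val (ratio s p)))%g mulgA ac [RHS]PCA ac.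
by rewrite -mulgA -[RHS]PCA -!star_valM ex xe.
Qed.

Section QuasiInverse.
Variables (lam : R) (g : l1 R (star S)).
Let x := lam%:C *: l1_delta R q \star f.
Hypothesis gE : g = x + g \star x.

Let on_orbit n (psi : star S -> R[i]) (y : star S) : R[i] :=
  if `[< orbit_upow n y >] then psi (ratio y (upow n)) else 0.

Let bounded_on_orbit n psi : bounded_fun psi -> bounded_fun (on_orbit n psi).
Proof.
move=> /bounded_ge0[C C0 psiC]; exists C => y; rewrite /on_orbit.
by case: ifP => _ //; rewrite Normc.normc0.
Qed.

Let pairing_x (chi : star S -> R[i]) : bounded_fun chi ->
  pairing x chi = lam%:C * pairing f (fun s => chi (q * s)%g).
Proof.
move=> chiB; rewrite /x convZl -[_ *: _]addr0 pairingDZl//.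
rewrite [pairing 0 chi]pairing0 ?addr0; last by move=> t; rewrite l1_zero eqxx.
by rewrite pairing_conv// pairing_delta.
Qed.

Let pairing_g (chi : star S -> R[i]) : bounded_fun chi ->
  pairing g chi = lam%:C * pairing f (fun s => chi (q * s)%g) +
    lam%:C * pairing g (fun t => pairing f (fun s => chi (t * (q * s))%g)).
Proof.
move=> chiB; have [C C0 chiC] := bounded_ge0 chiB.
have b1 : bounded_fun (fun t => pairing f (fun s => chi (t * (q * s))%g)).
  by apply: (@bounded_kernel R _ _ _ (fun s t => chi (t * (q * s))%g)); exists C => xy; exact: chiC.
rewrite [in LHS]gE -[X in pairing (X + _)]scale1r pairingDZl// mul1r pairing_x//; congr (_ + _).
rewrite pairing_conv// -[RHS]addr0 -(pairing0 (f := g) (chi := fun=> 0))//.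
rewrite -pairingDZr//; last by exists 0 => t; rewrite Normc.normc0.
apply: eq_pairing => t _; rewrite pairing_x ?addr0//.
by exists C.
Qed.

Lemma pairing_quasi_inverse n (psi : star S -> R[i]) : bounded_fun psi ->
  pairing g (on_orbit n psi) =
  lam%:C ^+ n.+1 * pairing (conv_pow e orbit_part n.+1) psi.
Proof.
elim: n psi => [|n IH] psi psiB; rewrite pairing_g; try exact: bounded_on_orbit.
  rewrite [X in _ + _ * X]pairing0; last first.
    move=> t _; apply: pairing0 => s fs; rewrite /on_orbit asboolF//; exact: orbit_upow0.
  rewrite mulr0 addr0 expr1 /= pairing_conv//.
  transitivity (lam%:C * pairing orbit_part psi); last first.
    congr (_ * _); apply: eq_pairing => r /orbit_part_on[_ re].
    by rewrite pairing_delta re.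
  rewrite pairing_orbit_part//; congr (_ * _); apply: eq_pairing => s fs.
  rewrite /on_orbit; case: (asboolP (orbit_p s)) => [Os|nOs].
    by have [Oqs ->] := orbit_step0 Os; rewrite asboolT.
  by rewrite asboolF// => /(orbit_upow_q fs)[].
rewrite [X in _ * X + _]pairing0 ?mulr0 ?add0r; last first.
  by move=> s fs; rewrite /on_orbit asboolF// => /(orbit_upow_q fs)[].
have [C psiC] := psiB.
have psiB2 : bounded_fun (fun rt : star S * star S => psi (rt.1 * rt.2)%g) by exists C.
pose psi' eta := pairing orbit_part (fun r => psi (r * eta)%g).
have psi'B : bounded_fun psi'.
  exact: (@bounded_kernel R _ orbit_part _ (fun r eta => psi (r * eta)%g)).
transitivity (lam%:C * pairing g (on_orbit n psi')).
  congr (_ * _); apply: eq_pairing => t _; rewrite /on_orbit /psi'.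
  case: (asboolP (orbit_upow n t)) => [Ot|nOt]; last first.
    by apply: pairing0 => s fs; rewrite asboolF// => /(orbit_upowS fs)[].
  rewrite pairing_orbit_part; last by exists C.
  apply: eq_pairing => s fs; case: (asboolP (orbit_p s)) => [Os|nOs].
    by have [Ots ->] := orbit_step Ot Os; rewrite asboolT.
  by rewrite asboolF// => /(orbit_upowS fs)[].
rewrite IH// mulrA -exprS; congr (_ * _).
rewrite (conv_powS _ _ n.+1); move: (conv_pow e orbit_part n.+1) => z.
by rewrite pairing_conv// pairing_swap.
Qed.

End QuasiInverse.

Lemma orbit_part_normal :
  l1_star invK orbit_part \star orbit_part = orbit_part \star l1_star invK orbit_part.
Proof.
apply: conv_comm => t r /(l1_on_star invH orbit_part_on) Ht fr.
by rewrite (orbit_part_central fr Ht).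
Qed.

Lemma l1_norm_pow n : l1_norm (conv_pow e orbit_part n) <= (l1_norm orbit_part *+ 2) ^+ n.
Proof.
elim: n => [|n IH]; first by rewrite l1_norm_delta.
rewrite conv_powS exprS; apply: le_trans (conv_norm_le _ _) _.
by rewrite -mulrnAl ler_wpM2l// mulrn_wge0// l1_norm_ge0.
Qed.

(* [phi^n] occurs with coefficient [lam^n] in the quasi-inverse [g] of
   [lam q f], which has finite norm, while its l^2 norm grows geometrically. *)
Lemma not_all_quasi_invertible : ~ forall lam : R, exists g,
  g = (lam%:C *: l1_delta R q \star f) + g \star (lam%:C *: l1_delta R q \star f).
Proof.
move=> quasi; pose phi := orbit_part; have phiH := orbit_part_on.
have phi0 : phi != 0.
  by apply/eqP => E; have := orbit_part_id; rewrite -/phi E l1_zero => /esym/eqP; apply/negP.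
pose D := l1_norm phi *+ 2.
have D0 : 0 < D.
  rewrite pmulrn_lgt0//; apply: lt_le_trans (l1_norm_ub phi e).
  rewrite lt_neqAle normc_ge0 andbT orbit_part_id.
  by apply: contra_neq fp => /esym/Normc.eq0_normc.
have Hl y : corner e y -> (e * y)%g = y by case.
have Hr y : corner e y -> (y * e)%g = y by case.
pose b := l1_inner phi phi; have b0 : 0 < b by exact: l1_inner_gt0 phi0.
pose lam := D *+ 2 / b.
have lam0 : 0 < lam by rewrite divr_gt0// mulrn_wgt0.
have [g gE] := quasi lam; pose C := l1_norm g *+ 2.
have bound n : (2 : R) ^+ n.+1 <= C.
  pose z := conv_pow e phi n.+1.
  have zD t : normc (z t)^* <= D ^+ n.+1.
    by rewrite normc_conj; apply: le_trans (l1_norm_ub _ _) (l1_norm_pow _).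
  have growth : b ^+ n.+1 <= l1_inner z z.
    exact: (normal_pow_growth (corner_id ee) (@cornerM _ _) Hl Hr invH Hvl phiH n.+1 orbit_part_normal phi0).
  have := pairing_quasi_inverse gE n (ex_intro _ _ zD : bounded_fun _).
  rewrite -/phi -/z => E.
  have : normc (lam%:C ^+ n.+1 * pairing z (fun t => (z t)^*)) <= (D ^+ n.+1 * l1_norm g) *+ 2.
    rewrite -E; apply: pairing_le; first by rewrite exprn_ge0// ltW.
    by move=> y; case: ifP => _; rewrite ?zD// Normc.normc0 exprn_ge0// ltW.
  rewrite -mulrnAr -/C.
  have lamE : lam%:C ^+ n.+1 = (lam ^+ n.+1)%:C :> R[i] by rewrite rmorphXn.
  rewrite Normc.normcM lamE /= expr0n addr0 sqrtr_sqr ger0_norm ?exprn_ge0 ?(ltW lam0)//.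
  have zb : b ^+ n.+1 <= normc (pairing z (fun t => (z t)^*)).
    by apply: le_trans growth (le_trans (ler_norm _) (Re_le_normc _)).
  move=> /(le_trans (ler_wpM2l (exprn_ge0 n.+1 (ltW lam0)) zb)).
  rewrite -exprMn divfK ?gt_eqF// -[D *+ 2]mulr_natr exprMn.
  by rewrite ler_pM2l// exprn_gt0.
have C0 : 0 <= C by rewrite mulrn_wge0// l1_norm_ge0.
have := archi_boundP C0; set N := Num.bound C => CN.
have := le_lt_trans (bound N) CN; rewrite -natrX ltr_nat.
by rewrite ltnNge (leq_trans (ltnW (ltnSn N)) (ltnW (ltn_expl _ _))).
Qed.

End Powers.

Lemma support_outside_not_jacobson : ~ jacobson_radical (@conv R (star S)) f.
Proof.
move=> Jf; have [q [qsep qcancel]] := support_point.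
have [inv [invK invH Hvl]] := corner_inverse ee emin.
apply: (not_all_quasi_invertible qsep qcancel invK invH Hvl) => lam.
exact: (jacobson_left_quasi_inverse (@convA R _) (@convDZl R _) (@convDZr R _) _ Jf).
Qed.

End SupportInMinIdeal.

Theorem theorem6p2 (R : realType) (S : cancelSemigroupType)
    (countableS : countable [set: S]) (abelianS : forall s t : S, (s * t)%g = (t * s)%g)
    (f : l1 R (star S)) :
  (jacobson_radical (@conv R (star S)) f <->
    supp f `<=` @min_ideal (star S) /\
    forall p q : star S, min_ideal p -> min_ideal q ->
      l1_delta R p \star f \star l1_delta R q = 0) /\
  (jacobson_radical (@conv R (star S)) f ->
    forall g : l1 R (star S),
      (g \star f) \star (g \star f) \star (g \star f) = 0).
Proof.
have /countable_injP[nu nu_inj'] := countableS.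
have nu_inj : injective nu by move=> s t; apply: nu_inj'; rewrite in_setT.
have JK : jacobson_radical (@conv R (star S)) f ->
    supp f `<=` @min_ideal (star S) /\
    forall p q : star S, min_ideal p -> min_ideal q ->
      l1_delta R p \star f \star l1_delta R q = 0.
  move=> Jf; split=> [p fp|p q Kp Kq].
    have [e [ee emin]] := star_minimal_idempotent p; apply: contrapT => npK.
    exact: (support_outside_not_jacobson nu_inj abelianS ee emin fp npK).
  have [e [ee emin]] := star_minimal_idempotent p.
  exact: (jacobson_min_ideal_sandwich ee emin Jf).
have nil : (supp f `<=` @min_ideal (star S) /\
    forall p q : star S, min_ideal p -> min_ideal q ->
      l1_delta R p \star f \star l1_delta R q = 0) ->
    forall (a : R[i]) (g : l1 R (star S)), let w := a *: f + g \star f in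
      w \star w \star w = 0.
  move=> [fK f0] a g w.
  have fK' : l1_on (@min_ideal (star S)) f by move=> t /fK.
  have idl (x y : star S) : min_ideal y -> min_ideal (x * y)%g by move=> /(min_idealM x)[].
  have idr (x y : star S) : min_ideal x -> min_ideal (x * y)%g by move=> /(min_idealM y)[].
  have wK : l1_on (@min_ideal (star S)) w.
    by apply: l1_onDZ => //; exact: conv_on_ideall.
  have wE : w = a *: f + g \star f by [].
  move: w wK wE => w wK wE; rewrite [X in _ \star X \star _]wE convDr convZr convDl convZl convA.
  rewrite (conv_sandwich_eq0 f0 wK wK) scaler0 add0r.
  by rewrite (conv_sandwich_eq0 f0 _ wK)//; exact: conv_on_idealr.
split; first split=> // /nil nilf.
  exact: (nilpotent_jacobson (@convA R _) (@convDZl R _) (@convDZr R _)).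
by move=> /JK/nil nilf g; have := nilf 0 g; rewrite scale0r add0r.
Qed.
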